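(* Let $(M,g)$ be a connected pseudo-Riemannian manifold which is concircularly recurrent, i.e. its concircular curvature tensor $\mathcal C$ is non-zero and there is a 1-form $\lambda$ on $M$ with $\nabla\mathcal C=\lambda\otimes\mathcal C$. Then $(M,g)$ is recurrent with the same recurrence form $\lambda$; that is, the Riemann curvature operator $\mathcal R$ is non-zero and $\nabla\mathcal R=\lambda\otimes\mathcal R$.
   Context: $(M,g)$ is a smooth pseudo-Riemannian manifold (metric $g$ of arbitrary signature) of dimension $n\geqslant 2$, assumed connected; $\nabla$ is the Levi-Civita connection, and all vector fields and forms are smooth. The Riemann curvature operator is $\mathcal R(X,Y)=[\nabla_X,\nabla_Y]-\nabla_{[X,Y]}$, regarded as the $(1,3)$-tensor field $(X,Y,Z)\mapsto\mathcal R(X,Y)Z$. The Ricci tensor is $S(Y,Z)=\mathrm{Trace}\{X\mapsto \mathcal R(X,Y)Z\}$ and the scalar curvature is $r=\mathrm{Trace}_g S$. Put $\mathcal G(X,Y)Z=g(Y,Z)X-g(X,Z)Y$. The concircular curvature tensor is the $(1,3)$-tensor field $$\mathcal C=\mathcal R-\frac{r}{n(n-1)}\,\mathcal G.$$ For a $(1,3)$-tensor field $\mathcal T$ and a 1-form $\lambda$, the equation $\nabla\mathcal T=\lambda\otimes\mathcal T$ means $(\nabla_V\mathcal T)(X,Y)Z=\lambda(V)\,\mathcal T(X,Y)Z$ for all vector fields $V,X,Y,Z$. $(M,g)$ is called recurrent if $\mathcal R$ is non-zero and $\nabla\mathcal R=\lambda\otimes\mathcal R$ for a certain 1-form $\lambda$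 (the recurrence form). $(M,g)$ is called concircularly recurrent if $\mathcal C$ is non-zero and $\nabla\mathcal C=\lambda\otimes\mathcal C$ for a certain 1-form $\lambda$ (the recurrence form). Since $M$ is connected, a tensor field satisfying such a recurrence equation that is not identically zero vanishes at no point, so ''non-zero'' may be read either as ''not identically zero'' or as ''non-zero at every point''. A concircularly recurrent manifold necessarily has $n\geqslant 3$, because $\mathcal C=0$ when $n=2$. *)

(* Defs.v *)
From mathcomp Require Import all_boot all_order all_algebra.
From mathcomp Require Import all_classical all_reals all_analysis.

Set Implicit Arguments.
Unset Strict Implicit.
Unset Printing Implicit Defensive.

Import Order.TTheory GRing.Theory Num.Theory.
Import numFieldNormedType.Exports.

Local Open Scope classical_set_scope.
Local Open Scope ring_scope.

(* Points and tangent vectors of R^n are row vectors.  A tensor field on a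
   manifold is a family of local expressions, one for each chart, living on the
   open image of the chart; the values of a local expression outside that image
   are irrelevant. *)

Section Smoothness.
Context (R : realType) (n : nat) (W : normedModType R).

Definition partial (i : 'I_n) (f : 'rV[R]_n -> W) : 'rV[R]_n -> W :=
  fun x => 'D_(delta_mx 0 i) f x.

(* C^oo on an open set U: all iterated partial derivatives (the empty iteration
   included) are Frechet differentiable, hence continuous, on U. *)
Definition smooth (U : set 'rV[R]_n) (f : 'rV[R]_n -> W) : Prop :=
  forall (s : seq 'I_n) x, U x -> differentiable (foldr partial f s) x.

End Smoothness.

Record chart (R : realType) (n : nat) (T : topologicalType) := Chart {
  chart_dom : set T;
  chart_coord : T -> 'rV[R]_n;
  chart_param : 'rV[R]_n -> T;
  chart_img := chart_coord @` chart_dom;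
  chart_dom_open : open chart_dom;
  chart_img_open : open chart_img;
  chart_coordK : forall p, chart_dom p -> chart_param (chart_coord p) = p;
  chart_coord_continuous : {within chart_dom, continuous chart_coord};
  chart_param_continuous : {within chart_img, continuous chart_param} }.

Definition overlap (R : realType) (n : nat) (T : topologicalType)
    (a b : chart R n T) : set 'rV[R]_n :=
  chart_coord a @` (chart_dom a `&` chart_dom b).

Definition transition (R : realType) (n : nat) (T : topologicalType)
    (a b : chart R n T) : 'rV[R]_n -> 'rV[R]_n :=
  chart_coord b \o chart_param a.

Record smoothManifold (R : realType) (n : nat) := SmoothManifold {
  points :> topologicalType;
  manifold_hausdorff : hausdorff_space points;
  manifold_countable : @second_countable points;
  atlas : set (chart R n points);
  atlas_cover : forall p : points, exists2 a, atlas a & chart_dom a p;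
  atlas_smooth : forall a b, atlas a -> atlas b ->
    smooth (overlap a b) (transition a b) }.

(* The library's Jacobian acts on row vectors: the differential of f at x is
   v |-> v *m 'J f x.  The transformation rules of the next two records say that
   the local expression in the chart a is the pullback of the one in b. *)

Record pseudoRiemannianMetric (R : realType) (n : nat)
    (M : smoothManifold R n) := PseudoRiemannianMetric {
  metric_mx :> chart R n M -> 'rV[R]_n -> 'M[R]_n;
  metric_smooth : forall a, atlas a -> smooth (chart_img a) (metric_mx a);
  metric_sym : forall a x, atlas a -> chart_img a x ->
    (metric_mx a x)^T = metric_mx a x;
  metric_nondegenerate : forall a x, atlas a -> chart_img a x ->
    metric_mx a x \in unitmx;
  metric_transition : forall a b x, atlas a -> atlas b -> overlap a b x ->
    metric_mx a x =
      'J (transition a b) x *m metric_mx b (transition a b x)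
        *m ('J (transition a b) x)^T }.

Record oneForm (R : realType) (n : nat) (M : smoothManifold R n) := OneForm {
  form_col :> chart R n M -> 'rV[R]_n -> 'cV[R]_n;
  form_smooth : forall a, atlas a -> smooth (chart_img a) (form_col a);
  form_transition : forall a b x, atlas a -> atlas b -> overlap a b x ->
    form_col a x = 'J (transition a b) x *m form_col b (transition a b x) }.

Section LocalGeometry.
Context (R : realType) (n : nat).

Local Notation point := 'rV[R]_n.
Local Notation field := (point -> 'rV[R]_n).

Implicit Types (U : set point) (X Y Z V : field).

Definition lie_bracket X Y : field :=
  fun x => 'D_(X x) Y x - 'D_(Y x) X x.

Definition inner (g : point -> 'M[R]_n) X Y : point -> R :=
  fun x => (X x *m g x *m (Y x)^T) 0 0.

Definition form_app (lam : point -> 'cV[R]_n) V : point -> R :=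
  fun x => (V x *m lam x) 0 0.

Record is_affine_connection U (D : field -> field -> field) : Prop := {
  conn_smooth : forall X Y, smooth U X -> smooth U Y -> smooth U (D X Y);
  conn_addl : forall X Y Z, smooth U X -> smooth U Y -> smooth U Z ->
    forall x, U x -> D (fun y => X y + Y y) Z x = D X Z x + D Y Z x;
  conn_scalel : forall (f : point -> R) X Y,
    smooth U f -> smooth U X -> smooth U Y ->
    forall x, U x -> D (fun y => f y *: X y) Y x = f x *: D X Y x;
  conn_addr : forall X Y Z, smooth U X -> smooth U Y -> smooth U Z ->
    forall x, U x -> D X (fun y => Y y + Z y) x = D X Y x + D X Z x;
  conn_leibniz : forall (f : point -> R) X Y,
    smooth U f -> smooth U X -> smooth U Y ->
    forall x, U x ->
      D X (fun y => f y *: Y y) x = 'D_(X x) f x *: Y x + f x *: D X Y x }.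

Record is_levi_civita U (g : point -> 'M[R]_n)
    (D : field -> field -> field) : Prop := {
  lc_connection : is_affine_connection U D;
  lc_torsion_free : forall X Y, smooth U X -> smooth U Y ->
    forall x, U x -> D X Y x - D Y X x = lie_bracket X Y x;
  lc_metric : forall X Y Z, smooth U X -> smooth U Y -> smooth U Z ->
    forall x, U x ->
      'D_(X x) (inner g Y Z) x = inner g (D X Y) Z x + inner g Y (D X Z) x }.

Context (g : point -> 'M[R]_n) (D : field -> field -> field).

Definition riemann X Y Z : field :=
  fun x => D X (D Y Z) x - D Y (D X Z) x - D (lie_bracket X Y) Z x.

(* Trace of the endomorphism v |-> R(v, Y)Z of the tangent space at x, the
   vector v being extended to a constant vector field. *)
Definition ricci Y Z : point -> R :=
  fun x => \tr (lin1_mx (fun v : 'rV[R]_n => riemann (fun _ => v) Y Z x)).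

Definition scalar_curvature : point -> R :=
  fun x => \tr (invmx (g x) *m
    \matrix_(i, j) ricci (fun _ => delta_mx 0 i) (fun _ => delta_mx 0 j) x).

Definition metric_curvature X Y Z : field :=
  fun x => inner g Y Z x *: X x - inner g X Z x *: Y x.

Definition concircular X Y Z : field :=
  fun x => riemann X Y Z x
    - (scalar_curvature x / (n%:R * (n%:R - 1))) *: metric_curvature X Y Z x.

Definition cov_deriv (T : field -> field -> field -> field) V X Y Z : field :=
  fun x => D V (T X Y Z) x
    - T (D V X) Y Z x - T X (D V Y) Z x - T X Y (D V Z) x.

Definition nonvanishing U (T : field -> field -> field -> field) : Prop :=
  forall x, U x -> exists X Y Z,
    [/\ smooth U X, smooth U Y, smooth U Z & T X Y Z x != 0].

Definition recurrence U (lam : point -> 'cV[R]_n)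
    (T : field -> field -> field -> field) : Prop :=
  forall V X Y Z, smooth U V -> smooth U X -> smooth U Y -> smooth U Z ->
    forall x, U x -> cov_deriv T V X Y Z x = form_app lam V x *: T X Y Z x.

End LocalGeometry.

Section GlobalGeometry.
Context (R : realType) (n : nat) (M : smoothManifold R n).

Definition connection : Type :=
  chart R n M -> ('rV[R]_n -> 'rV[R]_n) -> ('rV[R]_n -> 'rV[R]_n) ->
  'rV[R]_n -> 'rV[R]_n.

(* The local connections are determined on the chart images by uniqueness of
   the Levi-Civita connection, hence agree on overlaps. *)
Definition levi_civita (g : pseudoRiemannianMetric M)
    (nabla : connection) : Prop :=
  forall a, atlas a -> is_levi_civita (chart_img a) (g a) (nabla a).

Definition recurrent (nabla : connection) (lam : oneForm M) : Prop :=
  (forall a, atlas a -> nonvanishing (chart_img a) (riemann (nabla a))) /\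
  (forall a, atlas a ->
     recurrence (nabla a) (chart_img a) (lam a) (riemann (nabla a))).

Definition concircularly_recurrent (g : pseudoRiemannianMetric M)
    (nabla : connection) (lam : oneForm M) : Prop :=
  (forall a, atlas a ->
     nonvanishing (chart_img a) (concircular (g a) (nabla a))) /\
  (forall a, atlas a ->
     recurrence (nabla a) (chart_img a) (lam a) (concircular (g a) (nabla a))).

End GlobalGeometry.

(* Main.v *)
Require Import Defs.
From mathcomp Require Import all_boot all_order all_algebra.
From mathcomp Require Import all_classical all_reals all_analysis.
From mathcomp Require Import ring lra.

(* Write C = R - rho G with rho = r / (n (n - 1)), in a single chart, and let
   E.T be the derivation action of an endomorphism E on a tensor T.  Commuting
   second covariant derivatives of C gives R(U,V).C = (d lam)(U,V) C.  The
   endomorphisms R(U,V) are skew and hence annihilate G, so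
   R(U,V).R = (d lam)(U,V) C, and Walker's cyclic identity for R.R together
   with C <> 0 forces d lam = 0, that is R(U,V).C = 0.  Now
   nabla R = lam R + mu G with mu = d rho - rho lam, so differentiating
   R(U,V).C = 0 along W leaves mu(W) G(U,V).C = 0.  If mu(W) were nonzero at a
   point, C would be invariant there under all the skew endomorphisms G(U,V);
   contracting twice and using that the full trace of C vanishes would give
   C = 0.  Hence mu = 0. *)

Set Implicit Arguments.
Unset Strict Implicit.
Unset Printing Implicit Defensive.

Import Order.TTheory GRing.Theory Num.Theory.
Import numFieldNormedType.Exports.

Local Open Scope classical_set_scope.
Local Open Scope ring_scope.

(** * Smooth functions on an open set *)

(** The Levi-Civita connection is given only by its axioms on fields smooth on the chart image:
    there are no Christoffel symbols, and fields agreeing on that image are a priori different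
    arguments. Locality, tensoriality and the symmetries of R are therefore derived from the axioms;
    tensors are then frozen at a point, where the argument becomes linear algebra for a form with
    Gram matrix A of arbitrary signature. Walker's step: with pairs of vectors as indices, the
    identity reads a_i b_jk + a_j b_ki + a_k b_ij = 0, where a is d lam and b is C, symmetric under
    exchange of pairs; over the reals this forces a = 0 or b = 0. The final differentiation:
    nabla(R.C) = (nabla R).C + R.(nabla C) = 2 lam R.C + mu G.C, in which R.C already vanishes. The
    vanishing of the full trace of C is what rules out multiples of G, which are invariant under
    every G(U,V). *)

Section Calculus.
Context (R : realType) (n : nat).
Local Notation point := 'rV[R]_n.
Implicit Types (U : set point) (W : normedModType R).

(** Smoothness on U says nothing outside U, so formulas for derivatives can only be compared near a
    point. The differential of f satisfies the expansion that characterises the one of g. *)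
Lemma near_eq_differentiable W (f g : point -> W) x :
  (\near x, f x = g x) -> differentiable f x -> differentiable g x.
Proof.
move=> fg df.
have gE : g \o shift x = cst (g x) + 'd f x +o_ 0 id.
  apply/eqaddoP => e e0; have := diff_locally df; move/eqaddoP => /(_ e e0).
  have fg0 : \forall h \near 0, f (h + x) = g (h + x).
    by have := fg; rewrite (near_shift 0) /= subr0.
  move=> fe; near=> h.
  have -> : (g \o shift x - (cst (g x) + 'd f x)) h =
            (f \o shift x - (cst (f x) + 'd f x)) h.
    rewrite /= -(nbhs_singleton fg) /GRing.add /GRing.opp /=.
    by congr (_ - _); apply/esym; near: h.
  by near: h.
have dE := diff_unique (diff_continuous df) gE.
apply/diff_locallyP; rewrite dE; split; last exact: gE.
exact: diff_continuous df.
Unshelve. all: by end_near. Qed.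

Lemma smooth_differentiable W U (f : point -> W) x :
  smooth U f -> U x -> differentiable f x.
Proof. by move=> sf Ux; exact: (sf [::]). Qed.

Lemma smooth_derivable W U (f : point -> W) x v :
  smooth U f -> U x -> derivable f x v.
Proof. by move=> sf Ux; exact/diff_derivable/(smooth_differentiable sf). Qed.

Lemma smooth_partial W U (f : point -> W) i :
  smooth U f -> smooth U (partial i f).
Proof. by move=> sf s x Ux; have := sf (rcons s i) x Ux; rewrite foldr_rcons. Qed.

Lemma eq_open_near W U (f g : point -> W) x :
  open U -> (forall y, U y -> f y = g y) -> U x -> \near x, f x = g x.
Proof. by move=> oU fg Ux; near=> y; apply: fg; near: y; apply: open_nbhs_nbhs. 
Unshelve. all: by end_near. Qed.

Lemma eq_open_derive W U (f g : point -> W) x v :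
  open U -> (forall y, U y -> f y = g y) -> U x -> 'D_v f x = 'D_v g x.
Proof. by move=> oU fg Ux; exact/near_eq_derive/(eq_open_near oU fg). Qed.

Lemma foldr_partial_cst W (w : W) s (x : point) :
  foldr (@partial _ _ _) (fun=> w) s x = if s is [::] then w else 0.
Proof.
elim: s x => [|i s IH] x //=; rewrite /partial.
rewrite (_ : foldr _ _ s = cst (if s is [::] then w else 0)) ?derive_cst//.
exact/funext.
Qed.

Lemma smooth_cst W U (w : W) : smooth U (fun=> w).
Proof.
move=> s x _; rewrite (_ : foldr _ _ s = cst (if s is [::] then w else 0)).
  exact: differentiable_cst.
by apply/funext => y; exact: foldr_partial_cst.
Qed.

(** Smoothness truncated at order k. A derivative of a product is a sum of products of other
    functions, so closure under products is proved by induction on the order for all functions at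
    once, not on the list of directions. *)
Definition smooth_to W k U (f : point -> W) :=
  forall s x, (size s <= k)%N -> U x -> differentiable (foldr (@partial _ _ _) f s) x.

Lemma smooth_to0 W U (f : point -> W) :
  (forall x, U x -> differentiable f x) -> smooth_to 0 U f.
Proof. by move=> df [|//] x _ /df. Qed.

Lemma smooth_toS W k U (f : point -> W) :
  (forall x, U x -> differentiable f x) ->
  (forall i, smooth_to k U (partial i f)) -> smooth_to k.+1 U f.
Proof.
move=> df pf s x; case/lastP: s => [_ Ux|s i]; first exact: df.
by rewrite size_rcons foldr_rcons => sk Ux; apply: pf.
Qed.

Lemma smooth_to_partial W k U (f : point -> W) i :
  smooth_to k.+1 U f -> smooth_to k U (partial i f).
Proof.
by move=> sf s x sk Ux; rewrite -foldr_rcons; apply: sf; rewrite ?size_rcons.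
Qed.

Lemma smooth_to_differentiable W k U (f : point -> W) x :
  smooth_to k U f -> U x -> differentiable f x.
Proof. by move=> sf; exact: (sf [::]). Qed.

Lemma smooth_toW W k U (f : point -> W) : smooth_to k.+1 U f -> smooth_to k U f.
Proof. by move=> sf s x sk; apply: sf; exact: leqW. Qed.

Lemma smooth_toP W U (f : point -> W) :
  smooth U f <-> forall k, smooth_to k U f.
Proof. by split=> [sf k s x _|sf s x]; [exact: sf|exact: (sf (size s))]. Qed.

Lemma eq_smooth_to W k U (f g : point -> W) :
  open U -> (forall x, U x -> f x = g x) -> smooth_to k U f -> smooth_to k U g.
Proof.
move=> oU fg sf s x sk Ux.
suff E y : U y -> foldr (@partial _ _ _) f s y = foldr (@partial _ _ _) g s y.
  by apply: near_eq_differentiable (sf s x sk Ux); exact: eq_open_near oU E Ux.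
elim: s {sk} y => [|i s IH] y Uy /=; first exact: fg.
exact: eq_open_derive oU IH Uy.
Qed.


Lemma eq_smooth W U (f g : point -> W) :
  open U -> (forall x, U x -> f x = g x) -> smooth U f -> smooth U g.
Proof.
move=> oU fg /smooth_toP sf; apply/smooth_toP => k.
exact: eq_smooth_to oU fg (sf k).
Qed.

Lemma smooth_toD W k U (f g : point -> W) : open U ->
  smooth_to k U f -> smooth_to k U g -> smooth_to k U (fun x => f x + g x).
Proof.
move=> oU sf sg s x sk Ux.
suff E y : U y -> foldr (@partial _ _ _) f s y + foldr (@partial _ _ _) g s y =
    foldr (@partial _ _ _) (fun x => f x + g x) s y.
  apply: near_eq_differentiable (eq_open_near oU E Ux) _.
  by apply: differentiableD; [exact: sf|exact: sg].
elim: s sk y {x Ux} => [|i s IH] sk y Uy //=.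
transitivity ('D_(delta_mx 0 i) (fun y => foldr (@partial _ _ _) f s y +
    foldr (@partial _ _ _) g s y) y); last first.
  exact: eq_open_derive oU (IH (ltnW sk)) Uy.
by rewrite [RHS]deriveD//; apply: diff_derivable; [apply: sf|apply: sg];
  rewrite // ltnW.
Qed.

Lemma smooth_toM k U (f g : point -> R) : open U ->
  smooth_to k U f -> smooth_to k U g -> smooth_to k U (fun x => f x * g x).
Proof.
move=> oU; elim: k f g => [|k IH] f g sf sg.
  apply: smooth_to0 => x Ux; apply: differentiableM.
    exact: smooth_to_differentiable sf _.
  exact: smooth_to_differentiable sg _.
apply: smooth_toS => [x Ux|i].
  apply: differentiableM; first exact: smooth_to_differentiable sf _.
  exact: smooth_to_differentiable sg _.
apply: (@eq_smooth_to _ _ _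
  (fun x => f x * partial i g x + g x * partial i f x)) => //.
  move=> x Ux; rewrite /partial [RHS]deriveM//; apply: diff_derivable.
    exact: smooth_to_differentiable sf _.
  exact: smooth_to_differentiable sg _.
by apply: smooth_toD => //; apply: IH; rewrite ?smooth_toW//;
  [exact: smooth_toW|exact: smooth_to_partial|exact: smooth_toW
  |exact: smooth_to_partial].
Qed.

Lemma smooth_toV k U (f : point -> R) : open U ->
  (forall x, U x -> f x != 0) ->
  smooth_to k U f -> smooth_to k U (fun x => (f x)^-1).
Proof.
move=> oU f0; elim: k => [|k IH] sf.
  apply: smooth_to0 => x Ux; apply: differentiableV; last exact: f0.
  exact: smooth_to_differentiable sf _.
apply: smooth_toS => [x Ux|i].
  apply: differentiableV; last exact: f0.
  exact: smooth_to_differentiable sf _.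
(* The derivative of 1/f involves 1/f itself only up to order k, where the induction hypothesis
   applies. *)
apply: (@eq_smooth_to _ _ _
  (fun x => -1 * ((f x)^-1 * (f x)^-1 * partial i f x))) => //.
  move=> x Ux; rewrite /partial deriveV ?f0//; last first.
    exact/diff_derivable/(smooth_to_differentiable sf).
  by rewrite mulN1r -invfM -expr2 scaleNr.
apply: smooth_toM => //; first by move=> s x _; exact: smooth_cst.
have sV := IH (smooth_toW sf).
by do 2?apply: smooth_toM => //; exact: smooth_to_partial.
Qed.
End Calculus.

(** * Closure properties of smooth scalar and matrix fields *)

Section SmoothFields.
Context (R : realType) (n : nat) (U : set 'rV[R]_n).
Hypothesis oU : open U.
Local Notation point := 'rV[R]_n.
Implicit Types (f g : point -> R).

Lemma smoothM f g : smooth U f -> smooth U g -> smooth U (fun x => f x * g x).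
Proof.
by move=> /smooth_toP sf /smooth_toP sg; apply/smooth_toP => k; exact: smooth_toM.
Qed.

Lemma smoothV f : (forall x, U x -> f x != 0) -> smooth U f ->
  smooth U (fun x => (f x)^-1).
Proof.
by move=> f0 /smooth_toP sf; apply/smooth_toP => k; exact: smooth_toV.
Qed.

Lemma smoothD (W : normedModType R) (f g : point -> W) :
  smooth U f -> smooth U g -> smooth U (fun x => f x + g x).
Proof.
by move=> /smooth_toP sf /smooth_toP sg; apply/smooth_toP => k; exact: smooth_toD.
Qed.

Lemma smooth_sum (W : normedModType R) (I : Type) (r : seq I) (P : pred I)
    (F : I -> point -> W) :
  (forall i, P i -> smooth U (F i)) -> smooth U (fun x => \sum_(i <- r | P i) F i x).
Proof.
move=> sF; elim: r => [|i r IH].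
  by under eq_fun do rewrite big_nil; exact: smooth_cst.
case: (boolP (P i)) => Pi; last by under eq_fun do rewrite big_cons (negbTE Pi).
by under eq_fun do rewrite big_cons Pi; apply: smoothD => //; exact: sF.
Qed.

Lemma smooth_prod (I : Type) (r : seq I) (P : pred I) (F : I -> point -> R) :
  (forall i, P i -> smooth U (F i)) -> smooth U (fun x => \prod_(i <- r | P i) F i x).
Proof.
move=> sF; elim: r => [|i r IH].
  by under eq_fun do rewrite big_nil; exact: smooth_cst.
case: (boolP (P i)) => Pi; last by under eq_fun do rewrite big_cons (negbTE Pi).
by under eq_fun do rewrite big_cons Pi; apply: smoothM => //; exact: sF.
Qed.

Lemma smooth_mxP p q (F : point -> 'M[R]_(p, q)) :
  smooth U F <-> forall i j, smooth U (fun x => F x i j).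
Proof.
split=> sF.
  move=> i j s x Ux.
  suff E y : U y -> (foldr (@partial _ _ _) F s y) i j =
      foldr (@partial _ _ _) (fun z => F z i j) s y.
    apply: near_eq_differentiable (eq_open_near oU E Ux) _.
    by have := differentiable_comp (sF s x Ux) (@differentiable_coord _ _ _ _ i j).
  elim: s y {x Ux} => [|k s IH] y Uy //=.
  rewrite [in LHS]/partial derive_mx; last exact/diff_derivable/sF.
  by rewrite mxE; exact: eq_open_derive oU IH Uy.
move=> s x Ux.
have E y : U y -> \sum_i \sum_j foldr (@partial _ _ _) (fun z => F z i j) s y
    *: delta_mx i j = foldr (@partial _ _ _) F s y.
  move=> Uy; suff -> : foldr (@partial _ _ _) F s y =
      \matrix_(i, j) foldr (@partial _ _ _) (fun z => F z i j) s y.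
    rewrite [RHS]matrix_sum_delta; apply: eq_bigr => i _; apply: eq_bigr => j _.
    by rewrite mxE.
  elim: s y Uy => [|k s IH] y Uy /=; first by apply/matrixP => i j; rewrite mxE.
  rewrite [LHS]/partial (eq_open_derive _ oU IH Uy) derive_mx.
    apply/matrixP => i j; rewrite !mxE.
    by under [in LHS]eq_fun do rewrite mxE.
  apply/derivable_mxP => i j; under eq_fun do rewrite mxE.
  exact/diff_derivable/sF.
apply: near_eq_differentiable (eq_open_near oU E Ux) _.
have -> : (fun y => \sum_i \sum_j foldr (@partial _ _ _) (fun z => F z i j) s y
    *: delta_mx i j) = \sum_i \sum_j (fun y =>
    foldr (@partial _ _ _) (fun z => F z i j) s y *: delta_mx i j).
  apply/funext => y; rewrite fct_sumE; apply: eq_bigr => i _.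
  by rewrite fct_sumE.
apply: differentiable_sum => i; apply: differentiable_sum => j.
by apply: differentiableZl; exact: sF.
Qed.

Lemma smoothZ p q f (F : point -> 'M[R]_(p, q)) :
  smooth U f -> smooth U F -> smooth U (fun x => f x *: F x).
Proof.
move=> sf /smooth_mxP sF; apply/smooth_mxP => i j.
by under eq_fun do rewrite mxE; exact: smoothM.
Qed.

Lemma smooth_mulmx p q r (F : point -> 'M[R]_(p, q)) (G : point -> 'M[R]_(q, r)) :
  smooth U F -> smooth U G -> smooth U (fun x => F x *m G x).
Proof.
move=> /smooth_mxP sF /smooth_mxP sG; apply/smooth_mxP => i j.
by under eq_fun do rewrite mxE; apply: smooth_sum => k _; exact: smoothM.
Qed.

Lemma smooth_trmx p q (F : point -> 'M[R]_(p, q)) :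
  smooth U F -> smooth U (fun x => (F x)^T).
Proof.
move=> /smooth_mxP sF; apply/smooth_mxP => i j.
by under eq_fun do rewrite mxE; exact: sF.
Qed.

Lemma smoothN p q (F : point -> 'M[R]_(p, q)) :
  smooth U F -> smooth U (fun x => - F x).
Proof.
move=> sF; under eq_fun do rewrite -scaleN1r.
by apply: smoothZ => //; exact: smooth_cst.
Qed.

Lemma smoothB p q (F G : point -> 'M[R]_(p, q)) :
  smooth U F -> smooth U G -> smooth U (fun x => F x - G x).
Proof. by move=> sF sG; apply: smoothD => //; exact: smoothN. Qed.

Lemma smooth_det p (F : point -> 'M[R]_p) :
  smooth U F -> smooth U (fun x => \det (F x)).
Proof.
move=> /smooth_mxP sF; rewrite /determinant.
apply: smooth_sum => s _; apply: smoothM; first exact: smooth_cst.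
by apply: smooth_prod => i _; exact: sF.
Qed.

Lemma smooth_invmx p (F : point -> 'M[R]_p) :
  (forall x, U x -> F x \in unitmx) ->
  smooth U F -> smooth U (fun x => invmx (F x)).
Proof.
move=> uF sF.
(* Cramer's formula: the entries are cofactors divided by a nonvanishing determinant. *)
apply: (@eq_smooth _ _ _ _ (fun x => (\det (F x))^-1 *: \adj (F x))) => //.
  by move=> x Ux; rewrite /invmx uF.
apply: smoothZ.
  by apply: smoothV (smooth_det sF) => x /uF; rewrite unitmxE unitfE.
apply/smooth_mxP => i j; under eq_fun do rewrite mxE.
apply: smoothM; first exact: smooth_cst.
apply: smooth_det; apply/smooth_mxP => k l; under eq_fun do rewrite !mxE.
by move/smooth_mxP : sF; exact.
Qed.

Lemma derive_partial (W : normedModType R) (f : point -> W) x v :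
  differentiable f x -> 'D_v f x = \sum_i v 0 i *: partial i f x.
Proof.
move=> df; rewrite deriveE// {1}(row_sum_delta v) linear_sum.
by apply: eq_bigr => i _; rewrite linearZ /partial deriveE.
Qed.

Lemma smooth_derive f (X : point -> point) :
  smooth U X -> smooth U f -> smooth U (fun x => 'D_(X x) f x).
Proof.
move=> /smooth_mxP sX sf.
apply: (@eq_smooth _ _ _ _ (fun x => \sum_i X x 0 i *: partial i f x)) => //.
  by move=> x Ux; rewrite derive_partial//; exact: smooth_differentiable sf Ux.
by apply: smooth_sum => i _; apply: smoothM => //; exact: smooth_partial.
Qed.

Lemma derive_entry p q (F : point -> 'M[R]_(p, q)) x v i j :
  smooth U F -> U x -> ('D_v F x) i j = 'D_v (fun y => F y i j) x.
Proof. by move=> sF Ux; rewrite derive_mx ?mxE//; exact: smooth_derivable sF Ux. Qed.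

Lemma smooth_derive_mx p q (F : point -> 'M[R]_(p, q)) (X : point -> point) :
  smooth U X -> smooth U F -> smooth U (fun x => 'D_(X x) F x).
Proof.
move=> sX sF; apply/smooth_mxP => i j.
apply: (@eq_smooth _ _ _ _ (fun x => 'D_(X x) (fun y => F y i j) x)) => //.
  by move=> x Ux; rewrite derive_entry.
by apply: smooth_derive => //; move/smooth_mxP : sF; exact.
Qed.
End SmoothFields.

(** * Symmetry of second partial derivatives *)

Section MixedPartials.
Context (R : realType) (n : nat) (U : set 'rV[R]_n).
Hypothesis oU : open U.
Local Notation point := 'rV[R]_n.
Implicit Types (f : point -> R) (x u v : point).

Lemma is_derive_line f x u (t : R) : differentiable f (x + t *: u) ->
  is_derive t (1 : R) (fun s : R => f (x + s *: u)) ('D_u f (x + t *: u)).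
Proof.
move=> df; pose l (s : R) := x + s *: u.
have dl : is_diff t l (fun s => s *: u).
  by apply: is_diff_eq; rewrite add0r.
have dfl : differentiable (f \o l) t.
  by apply: differentiable_comp => //; case: dl.
split; first exact: diff_derivable.
by case: dl => dl lE; rewrite deriveE// diff_comp//= lE scale1r deriveE.
Qed.

(** The mean value theorem applied twice, first along i to a difference of two values of f, then
    along j to the partial derivative so obtained. The left-hand side is symmetric in i and j, which
    is the point. *)
Lemma second_difference f x (i j : 'I_n) (h : R) : smooth U f -> 0 < h ->
  (forall s t : R, 0 <= s <= h -> 0 <= t <= h ->
     U (x + s *: delta_mx 0 i + t *: delta_mx 0 j)) ->
  exists st : R * R, [/\ 0 <= st.1 <= h, 0 <= st.2 <= h &
    f (x + h *: delta_mx 0 i + h *: delta_mx 0 j) - f (x + h *: delta_mx 0 i)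
      - f (x + h *: delta_mx 0 j) + f x =
    h ^+ 2 * partial j (partial i f)
      (x + st.1 *: delta_mx 0 i + st.2 *: delta_mx 0 j)].
Proof.
move=> sf h0 boxU; set u : point := delta_mx 0 i; set v : point := delta_mx 0 j.
have h00 : (0 : R) <= 0 <= h by rewrite lexx ltW.
have hh0 : 0 <= h <= h by rewrite lexx ltW.
pose phi s := f (x + h *: v + s *: u) - f (x + s *: u).
have dphi s : 0 <= s <= h -> is_derive s (1 : R) phi
    (partial i f (x + h *: v + s *: u) - partial i f (x + s *: u)).
  move=> sh; apply: is_deriveB; apply: is_derive_line.
    by apply: smooth_differentiable sf _; rewrite addrAC; exact: boxU.
  apply: smooth_differentiable sf _.
  by have := boxU s 0 sh h00; rewrite scale0r addr0.
have [s /[!in_itv]/= sh phiE] := MVT_segment (ltW h0)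
  (fun s (sh : s \in `]0, h[) => dphi s
    (let: conj a b := andP sh in introT andP (conj (ltW a) (ltW b))))
  (derivable_within_continuous (fun s (sh : s \in `[0, h]) =>
    @ex_derive _ _ _ _ _ _ _ (dphi s sh))).
pose psi t := partial i f (x + s *: u + t *: v).
have spf := smooth_partial i sf.
have dpsi t : 0 <= t <= h -> is_derive t (1 : R) psi
    (partial j (partial i f) (x + s *: u + t *: v)).
  by move=> th; apply: is_derive_line; apply: smooth_differentiable spf _; exact: boxU.
have [t /[!in_itv]/= th psiE] := MVT_segment (ltW h0)
  (fun s (sh : s \in `]0, h[) => dpsi s
    (let: conj a b := andP sh in introT andP (conj (ltW a) (ltW b))))
  (derivable_within_continuous (fun s (sh : s \in `[0, h]) =>
    @ex_derive _ _ _ _ _ _ _ (dpsi s sh))).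
exists (s, t); split => //=.
move: phiE psiE; rewrite /phi /psi !scale0r !addr0 !subr0 => phiE psiE.
rewrite [x + h *: v + s *: u]addrAC psiE in phiE.
rewrite [x + h *: u + h *: v]addrAC.
by rewrite expr2 mulrC mulrA -phiE; ring.
Qed.

Lemma common_radius (p q : point -> R) x e :
  U x -> {for x, continuous p} -> {for x, continuous q} -> 0 < e ->
  exists2 d, 0 < d & forall y, `|x - y| < d ->
    [/\ U y, `|p x - p y| < e & `|q x - q y| < e].
Proof.
move=> Ux /cvgrPdist_lt cp /cvgrPdist_lt cq e0.
have nU : nbhs x U by exact: open_nbhs_nbhs.
have nP : nbhs x (U `&`
    ([set y | `|p x - p y| < e] `&` [set y | `|q x - q y| < e])).
  by apply: filterI => //; apply: filterI; [exact: cp|exact: cq].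
case/nbhs_ballP : nP => d d0 dP; exists d => // y xy.
by have := dP y; rewrite -ball_normE => /(_ xy)[Uy []].
Qed.

(** The same second difference, read in both orders, equals h^2 times either mixed partial at a
    point close to x; continuity brings both back to x within e. *)
Lemma partialC f (i j : 'I_n) x : smooth U f -> U x ->
  partial i (partial j f) x = partial j (partial i f) x.
Proof.
move=> sf Ux; set p := partial i (partial j f); set q := partial j (partial i f).
have cont g : smooth U g -> {for x, continuous g}.
  by move=> sg; exact/differentiable_continuous/(smooth_differentiable sg).
have cp : {for x, continuous p} by apply: cont; do 2?apply: smooth_partial.
have cq : {for x, continuous q} by apply: cont; do 2?apply: smooth_partial.
apply/eqP; rewrite -subr_eq0 -normr_le0; apply/ler_addgt0Pl => e e0; rewrite addr0.
have e20 : 0 < e / 2 by rewrite divr_gt0.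
have [d d0 dP] := common_radius Ux cp cq e20.
set u : point := delta_mx 0 i; set v : point := delta_mx 0 j.
(* A box of side h has its points at distance at most h (|u| + |v|) from x; the added 1 makes this
   strictly less than d and the denominator positive. *)
pose h := d / (`|u| + `|v| + 1).
have w0 : 0 < `|u| + `|v| + 1 by rewrite ltr_wpDl// addr_ge0.
have h0 : 0 < h by rewrite divr_gt0.
have box (s t : R) : 0 <= s <= h -> 0 <= t <= h -> `|x - (x + s *: u + t *: v)| < d.
  move=> /andP[s0 sh] /andP[t0 th]; rewrite -addrA opprD addrA subrr sub0r normrN.
  apply: (le_lt_trans (ler_normD _ _)); rewrite !normrZ !ger0_norm//.
  apply: (@le_lt_trans _ _ (h * (`|u| + `|v|))).
    by rewrite mulrDr lerD// ler_wpM2r.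
  by rewrite /h mulrAC ltr_pdivrMr// ltr_pM2l// ltrDl.
have [[s t] /= [sh th E1]] :=
  second_difference sf h0 (fun s t sh th => let: And3 a _ _ := dP _ (box s t sh th) in a).
have box' (s' t' : R) : 0 <= s' <= h -> 0 <= t' <= h -> `|x - (x + s' *: v + t' *: u)| < d.
  by move=> sh' th'; rewrite addrAC; exact: box.
have [[s' t'] /= [sh' th' E2]] :=
  second_difference sf h0 (fun s t sh th => let: And3 a _ _ := dP _ (box' s t sh th) in a).
move: E1 E2; rewrite -/u -/v -/p -/q => E1 E2.
clearbody p q u v.
have [_ _ qe] := dP _ (box _ _ sh th).
have [_ pe _] := dP _ (box' _ _ sh' th').
have pq : p (x + s' *: v + t' *: u) = q (x + s *: u + t *: v).
  have h2 : h ^+ 2 != 0 by rewrite expf_neq0// gt_eqF.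
  apply: (mulfI h2); rewrite -E1 -E2 [x + h *: u + h *: v]addrAC.
  by rewrite [X in X + f x]addrAC.
rewrite -pq in qe.
have -> : p x - q x = (p x - p (x + s' *: v + t' *: u))
    - (q x - p (x + s' *: v + t' *: u)) by ring.
by rewrite [leRHS]splitr (le_trans (ler_normB _ _))// lerD// ltW.
Qed.
End MixedPartials.

(** * Lie brackets and the tensor criterion *)

Section Derivations.
Context (R : realType) (n : nat) (U : set 'rV[R]_n).
Hypothesis oU : open U.
Local Notation point := 'rV[R]_n.
Local Notation field := (point -> point).
Implicit Types (f h : point -> R) (X Y Z V : field) (x v : point).

Lemma derive_smoothM f h x v : smooth U f -> smooth U h -> U x ->
  'D_v (fun y => f y * h y) x = 'D_v f x * h x + f x * 'D_v h x.
Proof.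
move=> sf sh Ux; rewrite [LHS]deriveM 1?addrC 1?mulrC//.
  exact: smooth_derivable sf Ux.
exact: smooth_derivable sh Ux.
Qed.

Lemma derive_smoothD (W : normedModType R) (f h : point -> W) x v :
  smooth U f -> smooth U h -> U x ->
  'D_v (fun y => f y + h y) x = 'D_v f x + 'D_v h x.
Proof.
move=> sf sh Ux; rewrite [LHS]deriveD//.
  exact: smooth_derivable sf Ux.
exact: smooth_derivable sh Ux.
Qed.

Lemma derive_smooth_sum m (F : 'I_m -> point -> R) x v :
  (forall i, smooth U (F i)) -> U x ->
  'D_v (fun y => \sum_i F i y) x = \sum_i 'D_v (F i) x.
Proof.
move=> sF Ux; rewrite (_ : (fun y => _) = \sum_i F i); last first.
  by apply/funext => y; rewrite fct_sumE.
by rewrite derive_sum// => i; exact: smooth_derivable (sF i) Ux.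
Qed.

Lemma derive_smoothZ f X x v : smooth U f -> smooth U X -> U x ->
  'D_v (fun y => f y *: X y) x = 'D_v f x *: X x + f x *: 'D_v X x.
Proof.
move=> sf sX Ux; apply/rowP => i.
rewrite (@derive_entry _ _ U) //; last exact: smoothZ.
under eq_fun do rewrite mxE.
rewrite derive_smoothM //; last by move/(smooth_mxP oU) : sX; exact.
by rewrite !mxE (@derive_entry _ _ U).
Qed.

Lemma smooth_lie_bracket X Y :
  smooth U X -> smooth U Y -> smooth U (lie_bracket X Y).
Proof. by move=> sX sY; apply: smoothB => //; exact: smooth_derive_mx. Qed.

Lemma derive_mx_addv X x v w : smooth U X -> U x ->
  'D_(v + w) X x = 'D_v X x + 'D_w X x.
Proof.
move=> sX Ux; have dX := smooth_differentiable sX Ux.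
by rewrite !deriveE// linearD.
Qed.

Lemma derive_mx_scalev X x k v : smooth U X -> U x ->
  'D_(k *: v) X x = k *: 'D_v X x.
Proof.
move=> sX Ux; have dX := smooth_differentiable sX Ux.
by rewrite !deriveE// linearZ.
Qed.

(** The second-order terms cancel by [partialC], leaving the derivatives of the components of X and
    Y. Both the linearity of the curvature in its third argument and its skewness for the metric
    rest on this. *)
Lemma derive_lie_bracket f X Y x :
  smooth U f -> smooth U X -> smooth U Y -> U x ->
  'D_(lie_bracket X Y x) f x =
  'D_(X x) (fun y => 'D_(Y y) f y) x - 'D_(Y x) (fun y => 'D_(X y) f y) x.
Proof.
move=> sf sX sY Ux.
have sc Z i : smooth U Z -> smooth U (fun y => Z y 0 i).
  by move/(smooth_mxP oU); exact.
have spf i : smooth U (partial i f) by exact: smooth_partial.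
have E Z V : smooth U Z -> smooth U V ->
    'D_(Z x) (fun y => 'D_(V y) f y) x =
    \sum_i 'D_(Z x) V x 0 i * partial i f x +
    \sum_i \sum_j V x 0 i * (Z x 0 j * partial j (partial i f) x).
  move=> sZ sV.
  have -> : 'D_(Z x) (fun y => 'D_(V y) f y) x =
      'D_(Z x) (fun y => \sum_i V y 0 i * partial i f y) x.
    apply: (eq_open_derive _ oU) => // y Uy.
    by rewrite derive_partial //; exact: smooth_differentiable sf Uy.
  rewrite derive_smooth_sum //; last by move=> i; apply: smoothM => //; exact: sc.
  rewrite -big_split; apply: eq_bigr => i _ /=.
  rewrite derive_smoothM//; last exact: sc.
  rewrite (@derive_entry _ _ U)//; congr (_ + _).
  rewrite (derive_partial _ (smooth_differentiable (spf i) Ux)) mulr_sumr.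
  by apply: eq_bigr.
rewrite (E X Y)// (E Y X)// (derive_partial _ (smooth_differentiable sf Ux)).
have -> : \sum_i \sum_j X x 0 i * (Y x 0 j * partial j (partial i f) x) =
    \sum_i \sum_j Y x 0 i * (X x 0 j * partial j (partial i f) x).
  rewrite exchange_big; apply: eq_bigr => i _; apply: eq_bigr => j _.
  by rewrite mulrCA (partialC oU).
rewrite opprD addrACA subrr addr0 -sumrB; apply: eq_bigr => i _.
by rewrite -mulrBl !mxE.
Qed.

Lemma field_functional_coord (F : field -> field) X x :
  (forall Y Z, smooth U Y -> smooth U Z ->
     forall x, U x -> F (fun y => Y y + Z y) x = F Y x + F Z x) ->
  (forall f Y, smooth U f -> smooth U Y ->
     forall x, U x -> F (fun y => f y *: Y y) x = f x *: F Y x) ->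
  smooth U X -> U x -> F X x = \sum_i X x 0 i *: F (fun=> delta_mx 0 i) x.
Proof.
move=> FD FZ sX Ux; have sc i : smooth U (fun y => X y 0 i).
  by move/(smooth_mxP oU) : sX; exact.
have {1}-> : X = fun y => \sum_i X y 0 i *: delta_mx 0 i.
  by apply/funext => y; exact: row_sum_delta.
(* F is additive only on binary sums, hence the induction over a list; on the empty list,
   homogeneity with coefficient zero gives F 0 = 0. *)
have E (r : seq 'I_n) : F (fun y => \sum_(i <- r) X y 0 i *: delta_mx 0 i) x =
    \sum_(i <- r) X x 0 i *: F (fun=> delta_mx 0 i) x.
  elim: r => [|i r IH].
    rewrite big_nil; under eq_fun do rewrite big_nil.
    have := FZ _ _ (@smooth_cst _ _ _ U (0 : R)) (@smooth_cst _ _ _ U (0 : point)) x Ux.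
    by under eq_fun do rewrite scaler0; rewrite scale0r.
  rewrite big_cons -IH; under eq_fun do rewrite big_cons.
  have sZ j : smooth U (fun y => X y 0 j *: (delta_mx 0 j : point)).
    by apply: smoothZ => //; exact: smooth_cst.
  rewrite FD// ?FZ//; first exact: smooth_cst.
  by apply: smooth_sum.
exact: E.
Qed.

(** The tensor criterion. It serves below for each slot of a tensor and for the connection minus the
    flat derivative. *)
Lemma field_functional_ext (F : field -> field) X Y x :
  (forall Y Z, smooth U Y -> smooth U Z ->
     forall x, U x -> F (fun y => Y y + Z y) x = F Y x + F Z x) ->
  (forall f Y, smooth U f -> smooth U Y ->
     forall x, U x -> F (fun y => f y *: Y y) x = f x *: F Y x) ->
  smooth U X -> smooth U Y -> U x -> X x = Y x -> F X x = F Y x.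
Proof.
move=> FD FZ sX sY Ux XY.
by rewrite (field_functional_coord FD FZ sX)// (field_functional_coord FD FZ sY)// XY.
Qed.
End Derivations.

(** * Algebraic curvature tensors *)

Section CurvatureAlgebra.
Context (R : realFieldType) (n : nat) (A : 'M[R]_n).
Local Notation vec := 'rV[R]_n.
Implicit Types (u v w x y z : vec) (T : vec -> vec -> vec -> vec) (E : vec -> vec).

Definition dot u v : R := (u *m A *m v^T) 0 0.

Lemma dotDl u v w : dot (u + v) w = dot u w + dot v w.
Proof. by rewrite /dot !mulmxDl mxE. Qed.
Lemma dotZl k u w : dot (k *: u) w = k * dot u w.
Proof. by rewrite /dot -!scalemxAl mxE. Qed.
Lemma dotNl u w : dot (- u) w = - dot u w.
Proof. by rewrite -scaleN1r dotZl mulN1r. Qed.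
Lemma dotBl u v w : dot (u - v) w = dot u w - dot v w.
Proof. by rewrite dotDl dotNl. Qed.
Lemma dotDr u v w : dot u (v + w) = dot u v + dot u w.
Proof. by rewrite /dot linearD mulmxDr mxE. Qed.
Lemma dotZr k u w : dot u (k *: w) = k * dot u w.
Proof. by rewrite /dot linearZ -scalemxAr mxE. Qed.
Lemma dotNr u w : dot u (- w) = - dot u w.
Proof. by rewrite -scaleN1r dotZr mulN1r. Qed.
Lemma dotBr u v w : dot u (v - w) = dot u v - dot u w.
Proof. by rewrite dotDr dotNr. Qed.

Definition dotE := (dotDl, dotDr, dotBl, dotBr, dotNl, dotNr, dotZl, dotZr).

Lemma dot_delta i v : dot (delta_mx 0 i) v = (A *m v^T) i 0.
Proof. by rewrite /dot -mulmxA -rowE mxE. Qed.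

Lemma dot_deltas i j : dot (delta_mx 0 i) (delta_mx 0 j) = A i j.
Proof. by rewrite dot_delta trmx_delta -colE mxE. Qed.

Lemma dotC u v : A^T = A -> dot u v = dot v u.
Proof. by move=> At; rewrite /dot -[in LHS]At -(trmxK u) -!trmx_mul mxE trmxK mulmxA. Qed.

(** Linearity in the second argument follows from [cl_skew] and is therefore not listed. *)
Record curvature_like T : Prop := {
  cl_add1 : forall u u' v w, T (u + u') v w = T u v w + T u' v w;
  cl_scale1 : forall k u v w, T (k *: u) v w = k *: T u v w;
  cl_add3 : forall u v w w', T u v (w + w') = T u v w + T u v w';
  cl_scale3 : forall k u v w, T u v (k *: w) = k *: T u v w;
  cl_skew : forall u v w, T u v w = - T v u w;
  cl_bianchi : forall u v w, T u v w + T v w u + T w u v = 0;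
  cl_metric : forall u v w z, dot (T u v w) z = - dot (T u v z) w }.

Definition endo_act E T x y z : vec :=
  E (T x y z) - T (E x) y z - T x (E y) z - T x y (E z).

Definition wedge u v w : vec := dot v w *: u - dot u w *: v.

Definition ric T y z : R := \sum_i (T (delta_mx 0 i) y z) 0 i.

Definition scal T : R :=
  \tr (invmx A *m \matrix_(i, j) ric T (delta_mx 0 i) (delta_mx 0 j)).

Section CurvatureLike.
Variable T : vec -> vec -> vec -> vec.
Hypothesis cT : curvature_like T.

Lemma cl_dot_skew u v w z : dot (T u v w) z = - dot (T v u w) z.
Proof. by rewrite cl_skew// dotNl. Qed.

Lemma cl_dot_bianchi u v w z :
  dot (T u v w) z + dot (T v w u) z + dot (T w u v) z = 0.
Proof. by rewrite -!dotDl cl_bianchi// /dot !mul0mx mxE. Qed.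

(** The octahedron argument: the four Bianchi sums obtained by cycling the arguments, together with
    skewness in each pair, imply the exchange of pairs linearly. *)
Lemma cl_pair u v w z : dot (T u v w) z = dot (T w z u) v.
Proof.
have b1 := cl_dot_bianchi u v w z; have b2 := cl_dot_bianchi v w z u.
have b3 := cl_dot_bianchi w z u v; have b4 := cl_dot_bianchi z u v w.
have m := cl_metric cT; have s := cl_dot_skew.
move: (s w u v z) (m v w u z) (m w z u v) (s z v w u) (m v z w u).
move: (s z u w v) (m u z w v) (m u w v z) (s z u v w) (m u v w z) => *.
lra.
Qed.
End CurvatureLike.


(* Walker's identity: by pair symmetry each summand is a difference of
   commutators of curvature endomorphisms, and these cancel cyclically. *)
Lemma walker_sum T u v x y z w : A^T = A -> curvature_like T ->
  dot (endo_act (T u v) T x y z) w + dot (endo_act (T x y) T z w u) v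
    + dot (endo_act (T z w) T u v x) y = 0.
Proof.
move=> At cT; have m := cl_metric cT; have p := cl_pair cT.
have E a b c d e h : dot (endo_act (T a b) T c d e) h =
    dot (T a b (T c d e)) h - dot (T c d (T a b e)) h
    + dot (T a b (T e h c)) d - dot (T e h (T a b c)) d.
  rewrite /endo_act !dotE (p (T a b c)) (p c (T a b d)) (dotC _ (T a b d))//.
  by rewrite (m a b (T e h c) d); ring.
by rewrite !E; ring.
Qed.

(** If some a_i is nonzero, the indices (i,i,i) give 3 a_i b_ii = 0, then (i,i,l) give 2 a_i b_il =
    0, then (i,j,k) give a_i b_jk = 0, so b vanishes. *)
Lemma walker_alternative (I : Type) (a : I -> R) (b : I -> I -> R) :
  (forall i j, b i j = b j i) ->
  (forall i j k, a i * b j k + a j * b k i + a k * b i j = 0) ->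
  (exists i j, b i j != 0) -> forall i, a i = 0.
Proof.
move=> bC ab [j [k bjk]] i; apply/eqP; apply: contraNT bjk => ai.
have bii : b i i = 0.
  have := ab i i i; rewrite -mulrDl -mulrDl => /eqP; rewrite mulf_eq0 => /orP[|/eqP//].
  by rewrite -mulr2n -mulrSr mulrn_eq0 (negbTE ai).
have bi l : b i l = 0.
  have := ab i i l; rewrite bii mulr0 addr0 (bC l i) -mulrDl => /eqP.
  by rewrite mulf_eq0 -mulr2n mulrn_eq0 (negbTE ai) => /eqP.
have := ab i j k; rewrite (bC k i) !bi !mulr0 !addr0 => /eqP.
by rewrite mulf_eq0 (negbTE ai).
Qed.

Lemma curvature_like_wedge : A^T = A -> curvature_like wedge.
Proof.
move=> At; rewrite /wedge; split=> [u u' v w|k u v w|u v w w'|k u v w|u v w|u v w|u v w z].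
- by rewrite !dotE scalerDr scalerDl; apply/rowP => i; rewrite !mxE; ring.
- by rewrite !dotE; apply/rowP => i; rewrite !mxE; ring.
- by rewrite !dotE; apply/rowP => i; rewrite !mxE; ring.
- by rewrite !dotE; apply/rowP => i; rewrite !mxE; ring.
- by rewrite opprB.
- by rewrite (dotC w v)// (dotC w u)// (dotC v u)//; apply/rowP => i; rewrite !mxE; ring.
- by rewrite !dotE (dotC u z)// (dotC v z)// (dotC u w)// (dotC v w)//; ring.
Qed.

Lemma curvature_likeB T1 T2 k : curvature_like T1 -> curvature_like T2 ->
  curvature_like (fun u v w => T1 u v w - k *: T2 u v w).
Proof.
move=> c1 c2; split=> [u u' v w|l u v w|u v w w'|l u v w|u v w|u v w|u v w z].
- by rewrite !cl_add1//; apply/rowP => i; rewrite !mxE; ring.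
- by rewrite !cl_scale1//; apply/rowP => i; rewrite !mxE; ring.
- by rewrite !cl_add3//; apply/rowP => i; rewrite !mxE; ring.
- by rewrite !cl_scale3//; apply/rowP => i; rewrite !mxE; ring.
- by rewrite (cl_skew c1) (cl_skew c2); apply/rowP => i; rewrite !mxE; ring.
- have := cl_bianchi c1 u v w; have := cl_bianchi c2 u v w.
  move=> /rowP b2 /rowP b1; apply/rowP => i.
  move: (b1 i) (b2 i); rewrite !mxE => e1 e2.
  by rewrite -[RHS](subr0 0) -{1}e1 -(mulr0 k) -e2; ring.
- by rewrite !dotE (cl_metric c1) (cl_metric c2); ring.
Qed.

Lemma scalB T1 T2 k :
  scal (fun u v w => T1 u v w - k *: T2 u v w) = scal T1 - k * scal T2.
Proof.
rewrite /scal -mxtraceZ scalemxAr -linearB /= -mulmxBr.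
congr (\tr (_ *m _)); apply/matrixP => i j; rewrite !mxE /ric mulr_sumr -sumrB.
by apply: eq_bigr => l _; rewrite !mxE.
Qed.

Lemma endo_actB E T1 T2 k x y z :
  (forall u v, E (u - v) = E u - E v) -> (forall k u, E (k *: u) = k *: E u) ->
  endo_act E (fun u v w => T1 u v w - k *: T2 u v w) x y z =
  endo_act E T1 x y z - k *: endo_act E T2 x y z.
Proof.
move=> EB EZ; rewrite /endo_act EB EZ.
by apply/rowP => i; rewrite !mxE; ring.
Qed.

(** [wedge] is built from the form alone, and a skew endomorphism is an infinitesimal isometry of
    the form. *)
Lemma endo_act_wedge E x y z : (forall u v, dot (E u) v = - dot u (E v)) ->
  (forall u v, E (u - v) = E u - E v) -> (forall k u, E (k *: u) = k *: E u) ->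
  endo_act E wedge x y z = 0.
Proof.
move=> sE EB EZ; rewrite /endo_act /wedge EB !EZ.
rewrite (sE y z) (sE x z); apply/rowP => i; rewrite !mxE; ring.
Qed.

(** The rows of [invmx A] are the basis dual to the standard one for the form, so contractions need
    no orthonormal basis. *)
Lemma sum_delta_dot v : A \in unitmx ->
  \sum_i dot v (delta_mx 0 i) *: row i (invmx A) = v.
Proof.
move=> uA; under eq_bigr do rewrite /dot trmx_delta -colE mxE.
by rewrite -mulmx_sum_row -mulmxA mulmxV// mulmx1.
Qed.

Lemma sum_dot_delta v w : \sum_i dot (delta_mx 0 i) v * w 0 i = dot w v.
Proof.
transitivity ((w *m (A *m v^T)) 0 0); last by rewrite mulmxA.
by rewrite mxE; apply: eq_bigr => i _; rewrite dot_delta mulrC.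
Qed.

Lemma dot_row_invmx v i : A^T = A -> A \in unitmx ->
  dot v (row i (invmx A)) = v 0 i.
Proof.
move=> At uA.
by rewrite /dot tr_row trmx_inv At colE mulmxA mulmxK// -colE mxE.
Qed.

(** The Ricci tensor of [wedge] is (n - 1) A. This is the origin of the constant in [concircular]:
    it makes the full trace of C vanish. *)
Lemma scal_wedge : A^T = A -> A \in unitmx -> scal wedge = n%:R * (n%:R - 1).
Proof.
move=> At uA.
have -> : scal wedge = \tr (invmx A *m ((n%:R - 1) *: A)).
  congr (\tr (_ *m _)); apply/matrixP => i j; rewrite !mxE /ric.
  under eq_bigr do rewrite /wedge !mxE eqxx !dot_deltas !andTb eqxx mulr1.
  rewrite sumrB sumr_const card_ord.
  rewrite (bigD1 i)//= eqxx mulr1 big1 ?addr0; last first.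
    by move=> k ki; rewrite (negbTE ki) mulr0.
  by rewrite mulrBl mul1r mulr_natl.
by rewrite -scalemxAr mulVmx// mxtraceZ mxtrace1 mulrC.
Qed.

(** The endomorphism [T u v] is skew for the form, so conjugation by A takes its matrix to minus its
    transpose, and its trace equals its own opposite. *)
Lemma cl_trace3 T u v : A^T = A -> A \in unitmx -> curvature_like T ->
  \sum_i (T u v (delta_mx 0 i)) 0 i = 0.
Proof.
move=> At uA cT; pose M := \matrix_(i, j) (T u v (delta_mx 0 i)) 0 j.
have -> : \sum_i (T u v (delta_mx 0 i)) 0 i = \tr M.
  by apply: eq_bigr => i _; rewrite mxE.
have dM i j : dot (T u v (delta_mx 0 i)) (delta_mx 0 j) = (M *m A) i j.
  have -> : T u v (delta_mx 0 i) = row i M by apply/rowP => k; rewrite !mxE.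
  by rewrite /dot trmx_delta -row_mul -colE !mxE.
have MA : M *m A = - (A *m M^T).
  apply/matrixP => i j; rewrite -dM (cl_metric cT) dM.
  by rewrite -[X in - (X *m _)]At -trmx_mul !mxE.
have : \tr M = - \tr M.
  rewrite -[M in LHS](mulmxK uA) MA mulNmx -scaleN1r mxtraceZ mulN1r.
  by rewrite mxtrace_mulC mulmxA mulVmx// mul1mx mxtrace_tr.
by move=> /eqP; rewrite -addr_eq0 -mulr2n mulrn_eq0 => /eqP.
Qed.

(** The trace over x of the invariance equation. The terms that are neither Ricci terms nor
    multiples of T(z,w)u form a Bianchi sum, apart from a trace killed by [cl_trace3]. *)
Lemma wedge_contraction T y z w u : A^T = A -> A \in unitmx -> curvature_like T ->
  (forall x, endo_act (wedge x y) T z w u = 0) ->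
  (n%:R - 1) * dot (T z w u) y = dot y z * ric T w u - dot y w * ric T z u.
Proof.
move=> At uA cT inv.
have coordE x i : 0 = dot y (T z w u) * x 0 i - dot x (T z w u) * y 0 i
    - dot y z * (T x w u) 0 i + dot x z * (T y w u) 0 i
    + dot y w * (T x z u) 0 i + dot x w * (T z y u) 0 i
    - dot y u * (T z w x) 0 i + dot x u * (T z w y) 0 i.
  transitivity ((endo_act (wedge x y) T z w u) 0 i); first by rewrite inv mxE.
  have lin1 k l a b c d : T (k *: a - l *: b) c d = k *: T a c d - l *: T b c d.
    by rewrite cl_add1// -scaleNr !cl_scale1// scaleNr.
  have lin3 k l a b c d : T c d (k *: a - l *: b) = k *: T c d a - l *: T c d b.
    by rewrite cl_add3// -scaleNr !cl_scale3// scaleNr.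
  rewrite /endo_act /wedge (cl_skew cT z (_ - _)) lin1 lin1 lin3.
  rewrite (cl_skew cT x z) (cl_skew cT z y) !mxE; ring.
(* Summing the i-th coordinate at x = e_i computes that trace. *)
have := erefl (\sum_(i < n) (0 : R)).
rewrite {2}big1// (eq_bigr _ (fun i _ => coordE (delta_mx 0 i) i)).
rewrite !(big_split, sumrN) /= -!mulr_sumr !sum_dot_delta.
rewrite cl_trace3// -!/(ric _ _ _).
under eq_bigr do rewrite mxE !eqxx.
rewrite sumr_const card_ord mulr0 (dotC y)// => E.
move: E (cl_dot_bianchi cT y z w u) (cl_metric cT y w u z) (cl_metric cT z y u w).
move: (cl_dot_skew cT z y w u) (cl_dot_skew cT w y z u).
rewrite /= -[_ *+ n]mulr_natr mul1r mulrBl mul1r => *.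
lra.
Qed.

(** Tracing [wedge_contraction] again, over w and u, gives (n - 1) Ric = scal A - Ric, hence n Ric =
    0 as scal = 0. The first contraction then reduces to (n - 1) T = 0. *)
Lemma wedge_invariant_eq0 T : (2 <= n)%N -> A^T = A -> A \in unitmx ->
  curvature_like T -> scal T = 0 ->
  (forall x y z w u, endo_act (wedge x y) T z w u = 0) ->
  forall z w u, T z w u = 0.
Proof.
move=> n2 At uA cT s0 inv.
have n0 : (n%:R : R) != 0 by rewrite pnatr_eq0 -lt0n (leq_trans _ n2).
have n10 : (n%:R - 1 : R) != 0 by rewrite subr_eq0 pnatr_eq1 gtn_eqF.
have contr y z w u := wedge_contraction At uA cT (fun x => inv x y z w u).
have ric_sum I (r : seq I) c (v : I -> vec) z :
    ric T z (\sum_(i <- r) c i *: v i) = \sum_(i <- r) c i * ric T z (v i).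
  elim: r => [|i r IH].
    rewrite !big_nil -(scale0r (0 : vec)) /ric big1// => i _.
    by rewrite cl_scale3// scale0r mxE.
  rewrite !big_cons -IH /ric mulr_sumr -big_split; apply: eq_bigr => j _ /=.
  by rewrite cl_add3// cl_scale3// !mxE.
have rowE i : row i (invmx A) = \sum_j invmx A i j *: delta_mx 0 j.
  by rewrite [LHS]row_sum_delta; apply: eq_bigr => j _; rewrite mxE.
have scalE : \sum_i ric T (delta_mx 0 i) (row i (invmx A)) = 0.
  transitivity (scal T); last by [].
  rewrite /scal mxtrace_mulC /mxtrace; apply: eq_bigr => i _.
  rewrite rowE ric_sum mxE; apply: eq_bigr => j _.
  have iC : (invmx A)^T = invmx A by rewrite trmx_inv At.
  by rewrite -[in LHS]iC !mxE mulrC.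
have ric0 z y : ric T z y = 0.
  have : \sum_i (n%:R - 1) * dot (T z (delta_mx 0 i) (row i (invmx A))) y =
         \sum_i (dot y z * ric T (delta_mx 0 i) (row i (invmx A))
                 - dot y (delta_mx 0 i) * ric T z (row i (invmx A))).
    by apply: eq_bigr => i _; rewrite contr.
  rewrite sumrB -!mulr_sumr scalE mulr0 sub0r -ric_sum sum_delta_dot//.
  have -> : \sum_i dot (T z (delta_mx 0 i) (row i (invmx A))) y = ric T z y.
    apply: eq_bigr => i _.
    by rewrite (cl_skew cT) dotNl (cl_metric cT) opprK dot_row_invmx.
  move=> E; suff : n%:R * ric T z y = 0.
    by move=> /eqP; rewrite mulf_eq0 (negbTE n0) => /eqP.
  by move: E; rewrite mulrBl mul1r; lra.
move=> z w u; rewrite -[LHS](sum_delta_dot _ uA) big1// => i _.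
have := contr (delta_mx 0 i) z w u; rewrite !ric0 !mulr0 subrr => /eqP.
by rewrite mulf_eq0 (negbTE n10) => /eqP ->; rewrite scale0r.
Qed.
End CurvatureAlgebra.

(** * Curvature in a chart *)

Section ChartGeometry.
Context (R : realType) (n : nat) (U : set 'rV[R]_n).
Local Notation point := 'rV[R]_n.
Local Notation field := (point -> point).
Local Notation tensor := (field -> field -> field -> field).
Hypothesis oU : open U.
Variables (g : point -> 'M[R]_n) (D : field -> field -> field).
Hypothesis sg : smooth U g.
Hypothesis g_sym : forall x, U x -> (g x)^T = g x.
Hypothesis g_unit : forall x, U x -> g x \in unitmx.
Hypothesis lcD : is_levi_civita U g D.
Implicit Types (X Y Z V W : field) (f : point -> R) (x : point) (T : tensor).

Let conn := lc_connection lcD.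

Lemma smooth_conn X Y : smooth U X -> smooth U Y -> smooth U (D X Y).
Proof. exact: conn_smooth conn _ _. Qed.

Lemma smooth_inner X Y : smooth U X -> smooth U Y -> smooth U (inner g X Y).
Proof.
move=> sX sY; suff : smooth U (fun x => X x *m g x *m (Y x)^T).
  by move/(smooth_mxP oU); exact.
by do 2?[apply: smooth_mulmx => //]; exact: smooth_trmx.
Qed.

Local Ltac sm := repeat first [ assumption | exact: smooth_cst
  | apply: smooth_conn | apply: smooth_lie_bracket | apply: smooth_inner
  | apply: smoothB | apply: smoothN | apply: smoothZ
  | apply: smoothD | apply: smooth_derive ].

(** Values of D and of derivatives become opaque vectors or scalars, the equations pushed into the
    goal are rewritten, and the rest is checked coordinate by coordinate. *)
Local Ltac vring :=
  repeat match goal with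
  | |- context [D ?X ?Y ?x] => generalize (D X Y x); intro
  | |- context [derive ?f ?x ?v] => generalize (derive f x v); intro
  end; do ?[move=> ->]; by apply/rowP => ?; rewrite !mxE; ring.

(** Locality of the connection: a value suffices in the first argument, agreement on U in the
    second. It allows rewriting under an outer D. *)
Lemma conn_ext X X' Y Y' x : smooth U X -> smooth U X' -> smooth U Y ->
  smooth U Y' -> U x -> X x = X' x -> (forall y, U y -> Y y = Y' y) ->
  D X Y x = D X' Y' x.
Proof.
move=> sX sX' sY sY' Ux XX YY.
rewrite (field_functional_ext oU (F := D ^~ Y) _ _ sX sX' Ux XX).
(* Subtracting the flat derivative removes the Leibniz term, so F is tensorial; the flat derivative
   is visibly local. *)
- pose F Z y := D X' Z y - 'D_(X' y) Z y.
  have : F Y x = F Y' x.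
    apply: (field_functional_ext oU _ _ sY sY' Ux (YY _ Ux)).
      move=> Z Z' sZ sZ' y Uy.
      rewrite /F (conn_addr conn)// (derive_smoothD _ sZ sZ')//.
      vring.
    move=> f Z sf sZ y Uy.
    rewrite /F (conn_leibniz conn)// (derive_smoothZ oU)//.
    vring.
  rewrite /F (eq_open_derive _ oU YY Ux) => /eqP.
  by rewrite -subr_eq0 opprD addrACA opprK addNr addr0 subr_eq0 => /eqP.
- by move=> Z Z' sZ sZ' y Uy; exact: (conn_addl conn).
- by move=> f Z sf sZ y Uy; exact: (conn_scalel conn).
Qed.

Lemma connNl X Y x : smooth U X -> smooth U Y -> U x ->
  D (fun y => - X y) Y x = - D X Y x.
Proof.
move=> sX sY Ux; rewrite -scaleN1r.
rewrite -(conn_scalel conn (@smooth_cst _ _ _ U (-1 : R)) sX sY Ux).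
by apply: conn_ext; sm; rewrite ?scaleN1r.
Qed.

Lemma connBl X X' Y x : smooth U X -> smooth U X' -> smooth U Y -> U x ->
  D (fun y => X y - X' y) Y x = D X Y x - D X' Y x.
Proof.
move=> sX sX' sY Ux; rewrite (conn_addl conn (Y := fun y => - X' y))//; sm.
by rewrite connNl.
Qed.

Lemma connBr X Y Y' x : smooth U X -> smooth U Y -> smooth U Y' -> U x ->
  D X (fun y => Y y - Y' y) x = D X Y x - D X Y' x.
Proof.
move=> sX sY sY' Ux; rewrite (conn_addr conn (Z := fun y => - Y' y))//; sm.
congr (_ + _); rewrite -scaleN1r.
have := conn_leibniz conn (@smooth_cst _ _ _ U (-1 : R)) sX sY' Ux.
rewrite (_ : 'D_(X x) _ x = 0) ?scale0r ?add0r; last exact: derive_cst.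
by under eq_fun do rewrite scaleN1r.
Qed.

Lemma conn0l Y x : smooth U Y -> U x -> D (fun=> 0) Y x = 0.
Proof.
move=> sY Ux; pose Z (y : point) : point := 0.
rewrite (_ : (fun=> 0) = fun y => Z y - Z y); last first.
  by apply/funext => y; rewrite subrr.
by rewrite connBl ?subrr//; exact: smooth_cst.
Qed.

Record tensorial T : Prop := {
  ts_smooth : forall X Y Z, smooth U X -> smooth U Y -> smooth U Z ->
    smooth U (T X Y Z);
  ts_add1 : forall X X' Y Z,
    smooth U X -> smooth U X' -> smooth U Y -> smooth U Z ->
    forall x, U x -> T (fun y => X y + X' y) Y Z x = T X Y Z x + T X' Y Z x;
  ts_scale1 : forall f X Y Z,
    smooth U f -> smooth U X -> smooth U Y -> smooth U Z ->
    forall x, U x -> T (fun y => f y *: X y) Y Z x = f x *: T X Y Z x;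
  ts_add3 : forall X Y Z Z',
    smooth U X -> smooth U Y -> smooth U Z -> smooth U Z' ->
    forall x, U x -> T X Y (fun y => Z y + Z' y) x = T X Y Z x + T X Y Z' x;
  ts_scale3 : forall f X Y Z,
    smooth U f -> smooth U X -> smooth U Y -> smooth U Z ->
    forall x, U x -> T X Y (fun y => f y *: Z y) x = f x *: T X Y Z x;
  ts_skew : forall X Y Z, smooth U X -> smooth U Y -> smooth U Z ->
    forall x, U x -> T X Y Z x = - T Y X Z x }.

(** * The curvature as a tensor and its symmetries *)

Lemma smooth_riemann X Y Z : smooth U X -> smooth U Y -> smooth U Z ->
  smooth U (riemann D X Y Z).
Proof. by move=> sX sY sZ; rewrite /riemann; sm. Qed.

Lemma riemann_tensorial : tensorial (riemann D).
Proof.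
split.
- exact: smooth_riemann.
- move=> X X' Y Z sX sX' sY sZ x Ux; rewrite /riemann.
  have E1 : D Y (D (fun y => X y + X' y) Z) x = D Y (D X Z) x + D Y (D X' Z) x.
    rewrite -(conn_addr conn)//; sm.
    by apply: conn_ext => [||||||y Uy]//; sm; rewrite (conn_addl conn).
  have E2 : D (lie_bracket (fun y => X y + X' y) Y) Z x =
      D (lie_bracket X Y) Z x + D (lie_bracket X' Y) Z x.
    rewrite -(conn_addl conn)//; sm.
    apply: conn_ext => [||||||]//; sm.
    rewrite /lie_bracket (derive_smoothD _ sX sX')// (derive_mx_addv _ _ sY)//.
    vring.
  have sYZ : smooth U (D Y Z) by sm.
  by move: E1 E2 (conn_addl conn sX sX' sYZ Ux); vring.
- move=> f X Y Z sf sX sY sZ x Ux; rewrite /riemann.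
  have E1 : D Y (D (fun y => f y *: X y) Z) x =
      'D_(Y x) f x *: D X Z x + f x *: D Y (D X Z) x.
    rewrite -(conn_leibniz conn)//; sm.
    by apply: conn_ext => [||||||y Uy]//; sm; rewrite (conn_scalel conn).
  have E2 : D (lie_bracket (fun y => f y *: X y) Y) Z x =
      f x *: D (lie_bracket X Y) Z x - 'D_(Y x) f x *: D X Z x.
    rewrite -(conn_scalel conn)//; sm.
    rewrite -(conn_scalel conn (f := fun y => 'D_(Y y) f y))//; sm.
    rewrite -connBl//; sm.
    apply: conn_ext => [||||||]//; sm.
    rewrite /lie_bracket (derive_smoothZ oU)// (derive_mx_scalev _ _ sY)//.
    vring.
  have sYZ : smooth U (D Y Z) by sm.
  by move: E1 E2 (conn_scalel conn sf sX sYZ Ux); vring.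
- move=> X Y Z Z' sX sY sZ sZ' x Ux; rewrite /riemann.
  have E V W : smooth U V -> smooth U W ->
      D V (D W (fun y => Z y + Z' y)) x = D V (D W Z) x + D V (D W Z') x.
    move=> sV sW; rewrite -(conn_addr conn)//; sm.
    by apply: conn_ext => [||||||y Uy]//; sm; rewrite (conn_addr conn).
  rewrite !E// (conn_addr conn)//; sm.
  vring.
- move=> f X Y Z sf sX sY sZ x Ux; rewrite /riemann.
  (* The mixed first-order terms are symmetric in V and W, and the second-order ones are absorbed by
     the bracket through [derive_lie_bracket]. *)
  have E V W : smooth U V -> smooth U W -> D V (D W (fun y => f y *: Z y)) x =
      'D_(V x) (fun y => 'D_(W y) f y) x *: Z x + 'D_(W x) f x *: D V Z x
      + ('D_(V x) f x *: D W Z x + f x *: D V (D W Z) x).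
    move=> sV sW; rewrite -!(conn_leibniz conn)//; sm.
    rewrite -(conn_addr conn)//; sm.
    by apply: conn_ext => [||||||y Uy]//; sm; rewrite (conn_leibniz conn).
  rewrite !E// (conn_leibniz conn)//; sm.
  rewrite (derive_lie_bracket oU)//.
  vring.
- move=> X Y Z sX sY sZ x Ux; rewrite /riemann.
  have E : D (lie_bracket X Y) Z x = - D (lie_bracket Y X) Z x.
    rewrite -connNl//; sm.
    by apply: conn_ext => //; sm; rewrite /lie_bracket opprB.
  by move: E; vring.
Qed.

Lemma conn_lie_cst Y x u v : smooth U Y -> U x ->
  D (lie_bracket (fun=> u) (fun=> v)) Y x = 0.
Proof.
move=> sY Ux; rewrite -(conn0l sY Ux); congr (D _ _ _); apply/funext => y.
by rewrite /lie_bracket !derive_cst subrr.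
Qed.

(** For a tensorial T any extension of the vectors gives the same value; constant ones have
    vanishing brackets. *)
Definition at_point T x (u v w : point) : point :=
  T (fun=> u) (fun=> v) (fun=> w) x.

Lemma ts_add2 T X Y Y' Z : tensorial T ->
  smooth U X -> smooth U Y -> smooth U Y' -> smooth U Z ->
  forall x, U x -> T X (fun y => Y y + Y' y) Z x = T X Y Z x + T X Y' Z x.
Proof.
move=> tT sX sY sY' sZ x Ux; rewrite ts_skew//; sm.
by rewrite ts_add1// opprD -!(ts_skew tT).
Qed.

Lemma ts_scale2 T f X Y Z : tensorial T ->
  smooth U f -> smooth U X -> smooth U Y -> smooth U Z ->
  forall x, U x -> T X (fun y => f y *: Y y) Z x = f x *: T X Y Z x.
Proof.
move=> tT sf sX sY sZ x Ux; rewrite ts_skew//; sm.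
by rewrite ts_scale1// -scalerN -(ts_skew tT).
Qed.

Lemma tensorial_ext T X X' Y Y' Z Z' x : tensorial T ->
  smooth U X -> smooth U X' -> smooth U Y -> smooth U Y' ->
  smooth U Z -> smooth U Z' -> U x -> X x = X' x -> Y x = Y' x -> Z x = Z' x ->
  T X Y Z x = T X' Y' Z' x.
Proof.
move=> tT sX sX' sY sY' sZ sZ' Ux XX YY ZZ.
have -> : T X Y Z x = T X' Y Z x.
  apply: (field_functional_ext oU (F := fun V => T V Y Z)) => //.
    by move=> *; apply: ts_add1.
  by move=> *; apply: ts_scale1.
have -> : T X' Y Z x = T X' Y' Z x.
  apply: (field_functional_ext oU (F := fun V => T X' V Z)) => //.
    by move=> *; apply: ts_add2.
  by move=> *; apply: ts_scale2.
apply: (field_functional_ext oU (F := T X' Y')) => //.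
  by move=> *; apply: ts_add3.
by move=> *; apply: ts_scale3.
Qed.

Lemma at_pointE T X Y Z x : tensorial T ->
  smooth U X -> smooth U Y -> smooth U Z -> U x ->
  T X Y Z x = at_point T x (X x) (Y x) (Z x).
Proof. by move=> tT sX sY sZ Ux; apply: tensorial_ext => //; sm. Qed.

(** For constant fields the bracket terms vanish and zero torsion makes D_b c = D_c b, so the six
    second derivatives cancel in pairs. *)
Lemma riemann_bianchi x (u v w : point) : U x ->
  at_point (riemann D) x u v w + at_point (riemann D) x v w u
    + at_point (riemann D) x w u v = 0.
Proof.
move=> Ux; have E0 a b c : at_point (riemann D) x a b c =
    D (fun=> a) (D (fun=> b) (fun=> c)) x - D (fun=> b) (D (fun=> a) (fun=> c)) x.
  rewrite -[RHS]subr0 /at_point /riemann; congr (_ - _).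
  by apply: conn_lie_cst; sm.
rewrite !E0.
have E a b c : D (fun=> a) (D (fun=> b) (fun=> c)) x =
    D (fun=> a) (D (fun=> c) (fun=> b)) x.
  apply: conn_ext => [||||||y Uy]//; sm.
  apply/eqP; rewrite -subr_eq0 (lc_torsion_free lcD)//; sm.
  by rewrite /lie_bracket !derive_cst subrr.
move: (E u v w) (E v w u) (E w u v); vring.
Qed.

(** Apply [X,Y] = XY - YX to the function g(Z,W) and use metric compatibility twice; the cross terms
    are symmetric in X and Y. *)
Lemma riemann_metric X Y Z W x :
  smooth U X -> smooth U Y -> smooth U Z -> smooth U W -> U x ->
  dot (g x) (riemann D X Y Z x) (W x) = - dot (g x) (riemann D X Y W x) (Z x).
Proof.
move=> sX sY sZ sW Ux.
have E V V' : smooth U V -> smooth U V' ->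
    'D_(V x) (fun y => 'D_(V' y) (inner g Z W) y) x =
    inner g (D V (D V' Z)) W x + inner g (D V' Z) (D V W) x
    + (inner g (D V Z) (D V' W) x + inner g Z (D V (D V' W)) x).
  move=> sV sV'; rewrite -!(lc_metric lcD)//; sm.
  rewrite -(derive_smoothD _ (U := U))//; sm.
  by apply: (eq_open_derive _ oU) => // y Uy; rewrite (lc_metric lcD).
have := derive_lie_bracket oU (smooth_inner sZ sW) sX sY Ux.
rewrite !E// (lc_metric lcD)//; sm.
rewrite /inner -!/(dot _ _ _) /riemann !dotBl.
rewrite !(dotC _ (Z x) (g_sym Ux)).
repeat match goal with
  | |- context [dot ?a ?b ?c] => generalize (dot a b c); intro
  end; lra.
Qed.

Lemma riemann_curvature_like x : U x ->
  curvature_like (g x) (at_point (riemann D) x).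
Proof.
move=> Ux; have tR := riemann_tensorial; rewrite /at_point; split => *.
- by apply: (ts_add1 tR); sm.
- by apply: (ts_scale1 tR (f := fun=> _)); sm.
- by apply: (ts_add3 tR); sm.
- by apply: (ts_scale3 tR (f := fun=> _)); sm.
- by apply: (ts_skew tR); sm.
- exact: riemann_bianchi.
- by apply: (riemann_metric (Z := fun=> _) (W := fun=> _)); sm.
Qed.

Lemma smooth_metric_curvature X Y Z :
  smooth U X -> smooth U Y -> smooth U Z -> smooth U (metric_curvature g X Y Z).
Proof. by move=> sX sY sZ; rewrite /metric_curvature; sm. Qed.

Lemma metric_curvatureE X Y Z x :
  metric_curvature g X Y Z x = wedge (g x) (X x) (Y x) (Z x).
Proof. by []. Qed.

Lemma metric_curvature_tensorial : tensorial (metric_curvature g).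
Proof.
have cW x := @curvature_like_wedge _ _ (g x).
split=> *; rewrite ?metric_curvatureE.
- exact: smooth_metric_curvature.
- by rewrite (cl_add1 (cW _ (g_sym _))).
- by rewrite (cl_scale1 (cW _ (g_sym _))).
- by rewrite (cl_add3 (cW _ (g_sym _))).
- by rewrite (cl_scale3 (cW _ (g_sym _))).
- by rewrite (cl_skew (cW _ (g_sym _))).
Qed.

Lemma tensorialB T1 T2 f : tensorial T1 -> tensorial T2 -> smooth U f ->
  tensorial (fun X Y Z x => T1 X Y Z x - f x *: T2 X Y Z x).
Proof.
move=> t1 t2 sf; split.
- move=> X Y Z sX sY sZ; apply: smoothB => //; first exact: (ts_smooth t1).
  by apply: smoothZ => //; exact: (ts_smooth t2).
- move=> X X' Y Z sX sX' sY sZ x Ux; rewrite (ts_add1 t1)// (ts_add1 t2)//.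
  by apply/rowP => i; rewrite !mxE; ring.
- move=> h X Y Z sh sX sY sZ x Ux; rewrite (ts_scale1 t1)// (ts_scale1 t2)//.
  by apply/rowP => i; rewrite !mxE; ring.
- move=> X Y Z Z' sX sY sZ sZ' x Ux; rewrite (ts_add3 t1)// (ts_add3 t2)//.
  by apply/rowP => i; rewrite !mxE; ring.
- move=> h X Y Z sh sX sY sZ x Ux; rewrite (ts_scale3 t1)// (ts_scale3 t2)//.
  by apply/rowP => i; rewrite !mxE; ring.
- move=> X Y Z sX sY sZ x Ux; rewrite (ts_skew t1 sX)// (ts_skew t2 sX)//.
  by rewrite scalerN opprB opprK addrC.
Qed.

Lemma scalar_curvatureE x :
  scalar_curvature g D x = scal (g x) (at_point (riemann D) x).
Proof.
rewrite /scalar_curvature /scal; congr (\tr (_ *m _)); apply/matrixP => i j.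
by rewrite !mxE /ricci /mxtrace; apply: eq_bigr => k _; rewrite mxE.
Qed.

Lemma smooth_scalar_curvature : smooth U (scalar_curvature g D).
Proof.
suff sM : smooth U (fun x => invmx (g x) *m \matrix_(i, j)
    ricci D (fun=> delta_mx 0 i) (fun=> delta_mx 0 j) x).
  by apply: smooth_sum => // i _; move/(smooth_mxP oU) : sM; exact.
apply: smooth_mulmx => //; first exact: smooth_invmx.
apply/(smooth_mxP oU) => i j; under eq_fun do rewrite mxE /ricci /mxtrace.
apply: smooth_sum => // k _; under eq_fun do rewrite mxE.
have : smooth U (riemann D (fun=> delta_mx 0 k) (fun=> delta_mx 0 i)
    (fun=> delta_mx 0 j)) by apply: smooth_riemann; sm.
by move/(smooth_mxP oU); exact.
Qed.

Lemma field_functional_riemann (F : field -> field) V W X x :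
  (forall Y Z, smooth U Y -> smooth U Z ->
     forall x, U x -> F (fun y => Y y + Z y) x = F Y x + F Z x) ->
  (forall f Y, smooth U f -> smooth U Y ->
     forall x, U x -> F (fun y => f y *: Y y) x = f x *: F Y x) ->
  smooth U V -> smooth U W -> smooth U X -> U x ->
  F (riemann D V W X) x =
    F (D V (D W X)) x - F (D W (D V X)) x - F (D (lie_bracket V W) X) x.
Proof.
move=> FD FZ sV sW sX Ux.
have FB Y Z : smooth U Y -> smooth U Z ->
    F (fun y => Y y - Z y) x = F Y x - F Z x.
  move=> sY sZ; under eq_fun do rewrite -scaleN1r.
  rewrite FD//; last by sm.
  by rewrite (FZ (fun=> -1))// ?scaleN1r//; sm.
rewrite {1}/riemann (FB (fun y => D V (D W X) y - D W (D V X) y)); sm.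
by rewrite FB//; sm.
Qed.

Local Ltac tring S :=
  repeat match goal with
  | |- context [D ?X ?Y ?x] => generalize (D X Y x); intro
  | |- context [derive ?f ?x ?v] => generalize (derive f x v); intro
  | |- context [S ?X ?Y ?Z ?x] => generalize (S X Y Z x); intro
  | |- context [form_app ?l ?X ?x] => generalize (form_app l X x); intro
  end; do ?[move=> ->]; by apply/rowP => ?; rewrite !mxE; ring.

(** * The Ricci identity for a recurrent tensor *)

Section Recurrence.
Variables (lam : point -> 'cV[R]_n) (T : tensor).
Hypothesis slam : smooth U lam.
Hypothesis tT : tensorial T.
Hypothesis recT : recurrence D U lam T.

Lemma smooth_form_app V : smooth U V -> smooth U (form_app lam V).
Proof.
move=> sV; suff : smooth U (fun x => V x *m lam x).
  by move/(smooth_mxP oU); exact.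
exact: smooth_mulmx.
Qed.

Lemma conn_recurrent V X Y Z x :
  smooth U V -> smooth U X -> smooth U Y -> smooth U Z -> U x ->
  D V (T X Y Z) x = form_app lam V x *: T X Y Z x +
    (T (D V X) Y Z x + (T X (D V Y) Z x + T X Y (D V Z) x)).
Proof.
move=> sV sX sY sZ Ux; rewrite -(recT sV sX sY sZ Ux) /cov_deriv.
by apply/rowP => i; rewrite !mxE; ring.
Qed.

(** The exterior derivative d lam, by its invariant formula. *)
Definition dform V W x : R := 'D_(V x) (form_app lam W) x
  - 'D_(W x) (form_app lam V) x - form_app lam (lie_bracket V W) x.

(** On antisymmetrising the second derivatives, lam(V) lam(W) T and all terms with a single
    derivative on an argument, or on two different arguments, drop out by symmetry in V and W. *)
Lemma ricci_identity V W X Y Z x :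
  smooth U V -> smooth U W -> smooth U X -> smooth U Y -> smooth U Z -> U x ->
  riemann D V W (T X Y Z) x - T (riemann D V W X) Y Z x
    - T X (riemann D V W Y) Z x - T X Y (riemann D V W Z) x
  = dform V W x *: T X Y Z x.
Proof.
move=> sV sW sX sY sZ Ux.
have sT X' Y' Z' : smooth U X' -> smooth U Y' -> smooth U Z' ->
  smooth U (T X' Y' Z') by exact: (ts_smooth tT).
have E2 V' W' : smooth U V' -> smooth U W' -> D V' (D W' (T X Y Z)) x =
    'D_(V' x) (form_app lam W') x *: T X Y Z x
    + form_app lam W' x *: D V' (T X Y Z) x
    + (D V' (T (D W' X) Y Z) x
      + (D V' (T X (D W' Y) Z) x + D V' (T X Y (D W' Z)) x)).
  move=> sV' sW'; have sL := smooth_form_app sW'.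
  have s1 : smooth U (T (D W' X) Y Z) by apply: sT => //; sm.
  have s2 : smooth U (T X (D W' Y) Z) by apply: sT => //; sm.
  have s3 : smooth U (T X Y (D W' Z)) by apply: sT => //; sm.
  have s0 := sT _ _ _ sX sY sZ.
  rewrite -(conn_leibniz conn)// -(conn_addr conn sV' s2 s3 Ux).
  rewrite -(conn_addr conn sV' s1)//; last by sm.
  rewrite -(conn_addr conn sV')//; sm.
  by apply: conn_ext => [||||||y Uy]//; sm; exact: conn_recurrent.
have r1 : T (riemann D V W X) Y Z x = _ :=
  field_functional_riemann (F := fun X => T X Y Z)
    (fun _ _ s s' _ u => ts_add1 tT s s' sY sZ u)
    (fun _ _ sf s _ u => ts_scale1 tT sf s sY sZ u) sV sW sX Ux.
have r2 : T X (riemann D V W Y) Z x = _ :=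
  field_functional_riemann (F := fun Y => T X Y Z)
    (fun _ _ s s' _ u => ts_add2 tT sX s s' sZ u)
    (fun _ _ sf s _ u => ts_scale2 tT sf sX s sZ u) sV sW sY Ux.
have r3 : T X Y (riemann D V W Z) x = _ :=
  field_functional_riemann (F := T X Y)
    (fun _ _ s s' _ u => ts_add3 tT sX sY s s' u)
    (fun _ _ sf s _ u => ts_scale3 tT sf sX sY s u) sV sW sZ Ux.
rewrite r1 r2 r3 /dform [X in X - _ - _ - _]/riemann.
have sB := smooth_lie_bracket oU sV sW.
have e X' Y' Z' V' : smooth U V' -> smooth U X' -> smooth U Y' -> smooth U Z' ->
  D V' (T X' Y' Z') x = _ := fun sV sX sY sZ => conn_recurrent sV sX sY sZ Ux.
move: (E2 V W sV sW) (E2 W V sW sV) (e X Y Z V sV sX sY sZ) (e X Y Z W sW sX sY sZ).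
move: (e X Y Z _ sB sX sY sZ).
move: (e _ Y Z V sV (smooth_conn sW sX) sY sZ) (e X _ Z V sV sX (smooth_conn sW sY) sZ).
move: (e X Y _ V sV sX sY (smooth_conn sW sZ)).
move: (e _ Y Z W sW (smooth_conn sV sX) sY sZ) (e X _ Z W sW sX (smooth_conn sV sY) sZ).
move: (e X Y _ W sW sX sY (smooth_conn sV sZ)).
tring T.
Qed.
End Recurrence.

Lemma conn_metric_curvature V X Y Z x :
  smooth U V -> smooth U X -> smooth U Y -> smooth U Z -> U x ->
  D V (metric_curvature g X Y Z) x = metric_curvature g (D V X) Y Z x
    + (metric_curvature g X (D V Y) Z x + metric_curvature g X Y (D V Z) x).
Proof.
move=> sV sX sY sZ Ux; rewrite /metric_curvature connBr//; sm.
rewrite !(conn_leibniz conn)//; sm.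
rewrite !(lc_metric lcD)//.
by apply/rowP => i; rewrite !mxE; ring.
Qed.

(** * From the recurrence of C to that of R *)

Section Concircular.
Variables (lam : point -> 'cV[R]_n).
Hypothesis slam : smooth U lam.
Hypothesis n2 : (2 <= n)%N.
Hypothesis recC : recurrence D U lam (concircular g D).
Hypothesis nvC : nonvanishing U (concircular g D).

Let rho x := scalar_curvature g D x / (n%:R * (n%:R - 1)).

Lemma smooth_rho : smooth U rho.
Proof.
by apply: smoothM => //; [exact: smooth_scalar_curvature|exact: smooth_cst].
Qed.

Lemma concircular_tensorial : tensorial (concircular g D).
Proof.
exact: tensorialB riemann_tensorial metric_curvature_tensorial smooth_rho.
Qed.

Lemma concircular_at_point x u v w : at_point (concircular g D) x u v w =
  at_point (riemann D) x u v w - rho x *: wedge (g x) u v w.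
Proof. by []. Qed.

Lemma concircular_curvature_like x : U x ->
  curvature_like (g x) (at_point (concircular g D) x).
Proof.
move=> Ux; apply: curvature_likeB; first exact: riemann_curvature_like.
exact: curvature_like_wedge (g_sym Ux).
Qed.

Lemma scal_concircular x : U x -> scal (g x) (at_point (concircular g D) x) = 0.
Proof.
move=> Ux; pose c : R := n%:R * (n%:R - 1).
have c0 : c != 0.
  by rewrite mulf_neq0 ?subr_eq0 ?pnatr_eq1 ?pnatr_eq0 ?gtn_eqF// ltnW.
rewrite [LHS]scalB scal_wedge ?g_sym ?g_unit// -scalar_curvatureE /rho.
by rewrite -/c divfK// subrr.
Qed.

Lemma concircular_nonzero x : U x -> exists u v w,
  at_point (concircular g D) x u v w != 0.
Proof.
move=> Ux; have [X [Y [Z [sX sY sZ]]]] := nvC Ux.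
rewrite (at_pointE concircular_tensorial)// => nz.
by exists (X x), (Y x), (Z x).
Qed.

Lemma endo_act_riemann_concircular x u v y z w : U x ->
  endo_act (at_point (riemann D) x u v) (at_point (concircular g D) x) y z w
  = dform lam (fun=> u) (fun=> v) x *: at_point (concircular g D) x y z w.
Proof.
move=> Ux; have tC := concircular_tensorial; have tR := riemann_tensorial.
rewrite -(ricci_identity slam tC recC)//; sm.
have sC : smooth U (concircular g D (fun=> y) (fun=> z) (fun=> w)).
  by apply: (ts_smooth tC); sm.
have sR a : smooth U (riemann D (fun=> u) (fun=> v) (fun=> a)).
  by apply: (ts_smooth tR); sm.
rewrite (at_pointE tR)//; sm; rewrite !(at_pointE tC)//; sm.
Qed.

Lemma dform0 x u v : U x -> dform lam (fun=> u) (fun=> v) x = 0.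
Proof.
move=> Ux; set C := at_point (concircular g D) x.
set K := at_point (riemann D) x.
have cC : curvature_like (g x) C := concircular_curvature_like Ux.
have cK : curvature_like (g x) K := riemann_curvature_like Ux.
have gs := g_sym Ux.
pose a (i : point * point) := dform lam (fun=> i.1) (fun=> i.2) x.
have nzC : exists u v w, C u v w != 0 := concircular_nonzero Ux.
(* C and R differ by a multiple of G, which the skew endomorphism [K i.1 i.2] annihilates; so the
   action on R equals the one on C. *)
have aK i y z w : endo_act (K i.1 i.2) K y z w = a i *: C y z w.
  have EB p q : K i.1 i.2 (p - q) = K i.1 i.2 p - K i.1 i.2 q.
    by rewrite (cl_add3 cK) -scaleN1r (cl_scale3 cK) scaleN1r.
  have EZ k p : K i.1 i.2 (k *: p) = k *: K i.1 i.2 p by exact: cl_scale3 cK _ _ _ _.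
  have E0 : endo_act (K i.1 i.2) (wedge (g x)) y z w = 0.
    by apply: endo_act_wedge => // p q; rewrite (cl_metric cK) dotC.
  have := endo_act_riemann_concircular i.1 i.2 y z w Ux.
  have CE : at_point (concircular g D) x =
    fun p q r => K p q r - rho x *: wedge (g x) p q r by [].
  by rewrite {1}CE (endo_actB _ _ _ _ _ _ EB EZ) E0 scaler0 subr0.
clearbody C K.
pose b (i j : point * point) := dot (g x) (C i.1 i.2 j.1) j.2.
suff a0 : forall i, a i = 0 by exact: (a0 (u, v)).
apply: (@walker_alternative _ _ a b).
- by move=> i j; exact: (cl_pair cC).
- move=> i j k; have := walker_sum i.1 i.2 j.1 j.2 k.1 k.2 gs cK.
  by rewrite (aK i) (aK j) (aK k) !dotZl.
(* Nondegeneracy of the metric turns a nonzero value of C into a nonzero entry of b. *)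
have [p [q [r nz]]] := nzC.
apply: contrapT => b0; move/eqP: nz; apply.
rewrite -[LHS](sum_delta_dot _ (g_unit Ux)) big1// => l _.
have -> : dot (g x) (C p q r) (delta_mx 0 l) = 0; last by rewrite scale0r.
apply/eqP/negPn/negP => bn; apply: b0.
by exists (p, q), (r, delta_mx 0 l).
Qed.

(* The defect of the recurrence of R: [nabla R = lam R + mu G]. *)
Let mu V x := 'D_(V x) rho x - rho x * form_app lam V x.

(** Differentiate R = C + rho G with nabla G = 0; writing lam C as lam R - rho lam G puts the
    remainder into [mu]. *)
Lemma conn_riemann V X Y Z x :
  smooth U V -> smooth U X -> smooth U Y -> smooth U Z -> U x ->
  D V (riemann D X Y Z) x = form_app lam V x *: riemann D X Y Z x
    + mu V x *: metric_curvature g X Y Z x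
    + (riemann D (D V X) Y Z x + (riemann D X (D V Y) Z x
       + riemann D X Y (D V Z) x)).
Proof.
move=> sV sX sY sZ Ux; have sr := smooth_rho.
have sC := ts_smooth concircular_tensorial sX sY sZ.
have sG := smooth_metric_curvature sX sY sZ.
have RE X' Y' Z' y : riemann D X' Y' Z' y =
    concircular g D X' Y' Z' y + rho y *: metric_curvature g X' Y' Z' y.
  by rewrite subrK.
have -> : D V (riemann D X Y Z) x = D V (concircular g D X Y Z) x
    + ('D_(V x) rho x *: metric_curvature g X Y Z x
       + rho x *: D V (metric_curvature g X Y Z) x).
  rewrite -(conn_leibniz conn)// -(conn_addr conn)//; sm.
  by congr (D V _ x); apply/funext => y; rewrite RE.
rewrite (conn_recurrent recC)// conn_metric_curvature// !RE /mu.
move: (concircular g D) (metric_curvature g) => C G.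
tring C.
Qed.

Lemma subr3_eq0 (V : zmodType) (a b c d : V) :
  a - b - c - d = 0 -> a = b + (c + d).
Proof. by move=> E; apply/eqP; rewrite -subr_eq0 -E !opprD !addrA. Qed.

(** The equation R.C = 0 for fields rather than vectors, so that it can be differentiated. *)
Lemma riemann_act_concircular A B X Y Z x :
  smooth U A -> smooth U B -> smooth U X -> smooth U Y -> smooth U Z -> U x ->
  riemann D A B (concircular g D X Y Z) x =
  concircular g D (riemann D A B X) Y Z x
  + (concircular g D X (riemann D A B Y) Z x
     + concircular g D X Y (riemann D A B Z) x).
Proof.
move=> sA sB sX sY sZ Ux; have tC := concircular_tensorial.
have tR := riemann_tensorial; have sR := smooth_riemann sA sB.
have := endo_act_riemann_concircular (A x) (B x) (X x) (Y x) (Z x) Ux.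
rewrite dform0// scale0r /endo_act.
rewrite -(at_pointE tR sA sB sX Ux) -(at_pointE tR sA sB sY Ux).
rewrite -(at_pointE tR sA sB sZ Ux) -(at_pointE tC sX sY sZ Ux).
rewrite -(at_pointE tR sA sB (ts_smooth tC sX sY sZ) Ux).
rewrite -(at_pointE tC (sR _ sX) sY sZ Ux) -(at_pointE tC sX (sR _ sY) sZ Ux).
rewrite -(at_pointE tC sX sY (sR _ sZ) Ux) => E.
exact: subr3_eq0.
Qed.

Section Functional.
Variables (F : field -> field).
Hypothesis FD : forall Y Z, smooth U Y -> smooth U Z ->
  forall x, U x -> F (fun y => Y y + Z y) x = F Y x + F Z x.
Hypothesis FZ : forall f Y, smooth U f -> smooth U Y ->
  forall x, U x -> F (fun y => f y *: Y y) x = f x *: F Y x.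

Lemma functional_conn_concircular V X Y Z x :
  smooth U V -> smooth U X -> smooth U Y -> smooth U Z -> U x ->
  F (D V (concircular g D X Y Z)) x =
    form_app lam V x *: F (concircular g D X Y Z) x +
    (F (concircular g D (D V X) Y Z) x + (F (concircular g D X (D V Y) Z) x
     + F (concircular g D X Y (D V Z)) x)).
Proof.
move=> sV sX sY sZ Ux; have sC := ts_smooth concircular_tensorial.
have s0 := sC _ _ _ sX sY sZ.
have s1 := sC _ _ _ (smooth_conn sV sX) sY sZ.
have s2 := sC _ _ _ sX (smooth_conn sV sY) sZ.
have s3 := sC _ _ _ sX sY (smooth_conn sV sZ).
(* F expects a field, whereas the recurrence is an equality at x. Freezing the coefficient at x
   yields a smooth field with the right value there, which is all a tensorial F sees. *)
have sk := @smooth_cst _ _ _ U (form_app lam V x).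
have sk0 := smoothZ oU sk s0; have s23 := smoothD oU s2 s3.
have s123 := smoothD oU s1 s23.
apply: etrans (field_functional_ext oU FD FZ (smooth_conn sV s0)
  (smoothD oU sk0 s123) Ux (conn_recurrent recC sV sX sY sZ Ux)) _.
apply: (etrans (FD sk0 s123 Ux)); congr (_ + _); first exact: (FZ sk s0 Ux).
by apply: (etrans (FD s1 s23 Ux)); congr (_ + _); exact: (FD s2 s3 Ux).
Qed.

Lemma functional_conn_riemann V X Y Z x :
  smooth U V -> smooth U X -> smooth U Y -> smooth U Z -> U x ->
  F (D V (riemann D X Y Z)) x =
    form_app lam V x *: F (riemann D X Y Z) x +
    mu V x *: F (metric_curvature g X Y Z) x +
    (F (riemann D (D V X) Y Z) x + (F (riemann D X (D V Y) Z) x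
     + F (riemann D X Y (D V Z)) x)).
Proof.
move=> sV sX sY sZ Ux; have sR := smooth_riemann.
have s0 := sR _ _ _ sX sY sZ.
have s1 := sR _ _ _ (smooth_conn sV sX) sY sZ.
have s2 := sR _ _ _ sX (smooth_conn sV sY) sZ.
have s3 := sR _ _ _ sX sY (smooth_conn sV sZ).
have s4 := smooth_metric_curvature sX sY sZ.
have sk := @smooth_cst _ _ _ U (form_app lam V x).
have sm := @smooth_cst _ _ _ U (mu V x).
have sk0 := smoothZ oU sk s0; have sm4 := smoothZ oU sm s4.
have s04 := smoothD oU sk0 sm4; have s23 := smoothD oU s2 s3.
have s123 := smoothD oU s1 s23.
apply: etrans (field_functional_ext oU FD FZ (smooth_conn sV s0)
  (smoothD oU s04 s123) Ux (conn_riemann sV sX sY sZ Ux)) _.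
apply: (etrans (FD s04 s123 Ux)); congr (_ + _).
  apply: (etrans (FD sk0 sm4 Ux)); congr (_ + _); first exact: (FZ sk s0 Ux).
  exact: (FZ sm s4 Ux).
by apply: (etrans (FD s1 s23 Ux)); congr (_ + _); exact: (FD s2 s3 Ux).
Qed.
End Functional.

(* Obtained by differentiating [R(A,B).C = 0] along [W]. *)
Lemma wedge_act_concircular W A B X Y Z x :
  smooth U W -> smooth U A -> smooth U B ->
  smooth U X -> smooth U Y -> smooth U Z -> U x ->
  mu W x *: endo_act (wedge (g x) (A x) (B x)) (at_point (concircular g D) x)
    (X x) (Y x) (Z x) = 0.
Proof.
move=> sW sA sB sX sY sZ Ux.
have tC := concircular_tensorial; have tR := riemann_tensorial.
have sR := smooth_riemann; have sC := ts_smooth tC.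
have sG := smooth_metric_curvature; have sD := smooth_conn.
have -> : endo_act (wedge (g x) (A x) (B x)) (at_point (concircular g D) x)
    (X x) (Y x) (Z x) = metric_curvature g A B (concircular g D X Y Z) x
    - concircular g D (metric_curvature g A B X) Y Z x
    - concircular g D X (metric_curvature g A B Y) Z x
    - concircular g D X Y (metric_curvature g A B Z) x.
  rewrite metric_curvatureE (at_pointE tC sX sY sZ Ux).
  rewrite (at_pointE tC (sG _ _ _ sA sB sX) sY sZ Ux).
  rewrite (at_pointE tC sX (sG _ _ _ sA sB sY) sZ Ux).
  by rewrite (at_pointE tC sX sY (sG _ _ _ sA sB sZ) Ux).
have H : D W (riemann D A B (concircular g D X Y Z)) x =
    D W (concircular g D (riemann D A B X) Y Z) x
    + (D W (concircular g D X (riemann D A B Y) Z) x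
       + D W (concircular g D X Y (riemann D A B Z)) x).
  have s1 := sC _ _ _ (sR _ _ _ sA sB sX) sY sZ.
  have s2 := sC _ _ _ sX (sR _ _ _ sA sB sY) sZ.
  have s3 := sC _ _ _ sX sY (sR _ _ _ sA sB sZ).
  have s23 := smoothD oU s2 s3.
  rewrite -(conn_addr conn sW s2 s3 Ux) -(conn_addr conn sW s1 s23 Ux).
  apply: conn_ext => // [||y Uy].
  - by apply: sR => //; exact: sC.
  - exact: smoothD.
  - exact: riemann_act_concircular.
have sDW V (sV : smooth U V) := sD _ _ sW sV.
have c0 := conn_riemann sW sA sB (sC _ _ _ sX sY sZ) Ux.
have c1 := conn_recurrent recC sW (sR _ _ _ sA sB sX) sY sZ Ux.
have c2 := conn_recurrent recC sW sX (sR _ _ _ sA sB sY) sZ Ux.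
have c3 := conn_recurrent recC sW sX sY (sR _ _ _ sA sB sZ) Ux.
have f0 : riemann D A B (D W (concircular g D X Y Z)) x = _ :=
  functional_conn_concircular (F := riemann D A B)
    (fun _ _ s s' _ u => ts_add3 tR sA sB s s' u)
    (fun _ _ sf s _ u => ts_scale3 tR sf sA sB s u) sW sX sY sZ Ux.
have f1 : concircular g D (D W (riemann D A B X)) Y Z x = _ :=
  functional_conn_riemann (F := fun X => concircular g D X Y Z)
    (fun _ _ s s' _ u => ts_add1 tC s s' sY sZ u)
    (fun _ _ sf s _ u => ts_scale1 tC sf s sY sZ u) sW sA sB sX Ux.
have f2 : concircular g D X (D W (riemann D A B Y)) Z x = _ :=
  functional_conn_riemann (F := fun Y => concircular g D X Y Z)
    (fun _ _ s s' _ u => ts_add2 tC sX s s' sZ u)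
    (fun _ _ sf s _ u => ts_scale2 tC sf sX s sZ u) sW sA sB sY Ux.
have f3 : concircular g D X Y (D W (riemann D A B Z)) x = _ :=
  functional_conn_riemann (F := concircular g D X Y)
    (fun _ _ s s' _ u => ts_add3 tC sX sY s s' u)
    (fun _ _ sf s _ u => ts_scale3 tC sf sX sY s u) sW sA sB sZ Ux.
(* Instances of R.C = 0: [e0] disposes of the lam terms, and [e1] to [e5], each with one argument
   differentiated along W, dispose of the terms carrying D W. Only mu(W) G.C is left. *)
have e := riemann_act_concircular.
have e0 := e _ _ _ _ _ _ sA sB sX sY sZ Ux.
have e1 := e _ _ _ _ _ _ (sDW _ sA) sB sX sY sZ Ux.
have e2 := e _ _ _ _ _ _ sA (sDW _ sB) sX sY sZ Ux.
have e3 := e _ _ _ _ _ _ sA sB (sDW _ sX) sY sZ Ux.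
have e4 := e _ _ _ _ _ _ sA sB sX (sDW _ sY) sZ Ux.
have e5 := e _ _ _ _ _ _ sA sB sX sY (sDW _ sZ) Ux.
move: H; rewrite {}c0 {}c1 {}c2 {}c3 => H.
move: f0 f1 f2 f3 e0 e1 e2 e3 e4 e5 H.
repeat match goal with
| |- context [riemann D ?X ?Y ?Z ?x] => generalize (riemann D X Y Z x); intro
| |- context [concircular g D ?X ?Y ?Z ?x] =>
    generalize (concircular g D X Y Z x); intro
| |- context [metric_curvature g ?X ?Y ?Z ?x] =>
    generalize (metric_curvature g X Y Z x); intro
| |- context [form_app ?l ?X ?x] => generalize (form_app l X x); intro
end.
generalize (mu W x) => muWx.
do 10 move=> ->.
move=> /eqP; rewrite -subr_eq0 => /eqP <-.
by apply/rowP => i; rewrite !mxE; ring.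
Qed.

Lemma mu0 W x : smooth U W -> U x -> mu W x = 0.
Proof.
move=> sW Ux; apply: contrapT => /eqP m0.
have [u [v [w]]] := concircular_nonzero Ux; move/eqP; apply.
have := wedge_invariant_eq0 n2 (g_sym Ux) (g_unit Ux)
  (concircular_curvature_like Ux) (scal_concircular Ux).
apply=> a b p q r; apply: (scalerI m0); rewrite scaler0.
have sc c := @smooth_cst _ _ _ U (c : point).
exact: (wedge_act_concircular sW (sc a) (sc b) (sc p) (sc q) (sc r) Ux).
Qed.

Lemma recurrence_riemann : recurrence D U lam (riemann D).
Proof.
move=> V X Y Z sV sX sY sZ x Ux.
rewrite /cov_deriv conn_riemann// mu0// scale0r addr0.
tring (riemann D).
Qed.

(** At a point rho is a multiple of a trace of R, so R = 0 there would force C = 0 there. *)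
Lemma nonvanishing_riemann : nonvanishing U (riemann D).
Proof.
move=> x Ux; apply: contrapT => R0.
have R00 u v w : at_point (riemann D) x u v w = 0.
  apply: contrapT => /eqP nz; apply: R0; exists (fun=> u), (fun=> v), (fun=> w).
  by split => //; exact: smooth_cst.
have rho0 : rho x = 0.
  rewrite /rho scalar_curvatureE /scal (_ : \matrix_(i, j) _ = 0).
    by rewrite mulmx0 mxtrace0 mul0r.
  by apply/matrixP => i j; rewrite !mxE /ric big1// => k _; rewrite R00 mxE.
have [u [v [w]]] := concircular_nonzero Ux.
by rewrite concircular_at_point R00 rho0 scale0r subr0 eqxx.
Qed.
End Concircular.
End ChartGeometry.

Theorem mainTheorem1 (R : realType) (n : nat) (M : smoothManifold R n)
    (g : pseudoRiemannianMetric M) (nabla : connection M) (lam : oneForm M) :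
  (2 <= n)%N ->
  connected [set: M] ->
  levi_civita g nabla ->
  concircularly_recurrent g nabla lam ->
  recurrent nabla lam.
Proof.
move=> n2 _ lc [nv rec].
split=> a aM; have sg := metric_smooth g aM; have oa := @chart_img_open _ _ _ a;
  have gs x := @Defs.metric_sym _ _ _ g a x aM;
  have gu x := @metric_nondegenerate _ _ _ g a x aM.
  exact: (nonvanishing_riemann oa sg gs gu (lc a aM) (nv a aM)).
exact: (recurrence_riemann oa sg gs gu (lc a aM) (form_smooth lam aM) n2
  (rec a aM) (nv a aM)).
Qed.
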